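(* Let $x>0$ and let $k\in(0,1)$ be the unique modulus with $x=K(k')/K(k)$. Then $$2\sum_{n=1}^\infty \frac{n^2\cosh(\pi n x)}{\sinh^2(\pi n x)}=\sum_{n=1}^\infty \frac{(2n-1)\cosh(\pi(2n-1)x/2)}{\sinh^3(\pi(2n-1)x/2)}=\frac{4}{\pi^4}K^2(k)\Big[k^2K^2(k)-\big(K(k)-E(k)\big)^2\Big].$$
   Context: For $k\in(0,1)$ let $k'=\sqrt{1-k^2}$, and let $K(k)=\int_0^1\frac{dt}{\sqrt{(1-t^2)(1-k^2t^2)}}$ and $E(k)=\int_0^1\sqrt{\frac{1-k^2t^2}{1-t^2}}\,dt$ be the complete elliptic integrals of the first and second kind. The map $k\mapsto x(k)=K(k')/K(k)$ is a strictly decreasing continuously differentiable bijection from $(0,1)$ onto $(0,\infty)$, so each $x>0$ determines a unique $k\in(0,1)$ with $x(k)=x$. *)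

(* Defs.v *)
From Stdlib Require Import Reals.
Open Scope R_scope.

Definition improper_int_0_1 (f : R -> R) (l : R) : Prop :=
  (forall b, 0 <= b < 1 -> inhabited (Riemann_integrable f 0 b)) /\
  (forall eps, 0 < eps -> exists delta, 0 < delta /\
     forall b (pr : Riemann_integrable f 0 b),
       0 <= b < 1 -> 1 - delta < b -> Rabs (RiemannInt pr - l) < eps).

Definition K_integrand (k : R) (t : R) : R :=
  1 / sqrt ((1 - t ^ 2) * (1 - k ^ 2 * t ^ 2)).
Definition E_integrand (k : R) (t : R) : R :=
  sqrt ((1 - k ^ 2 * t ^ 2) / (1 - t ^ 2)).

Definition is_K (k v : R) : Prop := improper_int_0_1 (K_integrand k) v.
Definition is_E (k v : R) : Prop := improper_int_0_1 (E_integrand k) v.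

Definition kprime (k : R) : R := sqrt (1 - k ^ 2).

(* Main.v *)
Require Import Defs.
From Stdlib Require Import Reals Ranalysis5 Lra Lia.
From Coquelicot Require Import Coquelicot.
Open Scope R_scope.

(** Put y = PI x, q = exp(-y) and m = k^2.  The logarithm of
    theta_4(q) = prod_n (1 - q^n) / (1 + q^n) satisfies
    - ln theta_4 = sum_n ln coth(n y / 2), whose second derivative in y is
    sum_n n^2 cosh(n y) / sinh(n y)^2, half of the first sum.  On the other
    hand theta_4(q)^2 = 2 k' K / PI: Gauss' product formula turns theta_4 into
    the series sum (-1)^s q^(s^2), product and series together show that
    (theta_3^2, theta_4^2) at q goes under the arithmetic-geometric mean to the
    same pair at q^2, and Landen's transformation evaluates K and K' along
    this iteration.  By Legendre's relation dy/dm = - PI^2 / (4 m (1 - m) K^2),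
    so differentiating - ln theta_4 = - ln (2 k' K / PI) / 2 twice in m expresses
    the second derivative in y through K and E.  The second sum is the same
    double series of exponentials, summed in the other order. *)

(** Three identities tie theta constants to elliptic integrals: theta_3(q)^2 + theta_4(q)^2 = 2
    theta_3(q^2)^2, and the values PI / 2 and - ln q / 2 of Gauss' integral at (theta_3^2,
    theta_4^2) and at (theta_3^2, theta_2^2). All three are proved by rigidity, without counting
    lattice points and without a limit along the mean iteration. The discrepancy of the two sides
    obeys an exact functional equation under q -> q^2; a crude estimate near q = 0 then forces it to
    vanish there, and the step from q^2 back to q carries the identity to the whole unit interval.
    The numerical constants below only have to be large enough for these estimates. Elliptic
    integrals are taken as functions of m = k^2: the complementary modulus becomes 1 - m, and the
    derivatives of K and E are rational in m, K and E. *)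

(** * Gauss' product and the theta series *)

Fixpoint gauss_prod (q : R) (n : nat) : R :=
  match n with
  | O => 1
  | S j => gauss_prod q j * ((1 - q ^ S j) / (1 + q ^ S j))
  end.

Fixpoint theta_partial (q : R) (n : nat) : R :=
  match n with
  | O => 1
  | S j => theta_partial q j + 2 * (-1) ^ S j * q ^ (S j * S j)
  end.

Lemma pow_abs_lt_1 (q : R) (n : nat) : Rabs q < 1 -> Rabs (q ^ S n) < 1.
Proof.
  intros Hq. rewrite <- RPow_abs. simpl.
  assert (0 <= Rabs q ^ n <= 1).
  { split. apply pow_le, Rabs_pos. rewrite <- (pow1 n). apply pow_incr. split. apply Rabs_pos. lra. }
  assert (H0 := Rabs_pos q). nra.
Qed.

Lemma one_minus_pow_pos (q : R) (n : nat) : Rabs q < 1 -> 0 < 1 - q ^ S n.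
Proof. intros Hq. apply (pow_abs_lt_1 q n) in Hq. apply Rabs_def2 in Hq. lra. Qed.

Lemma one_plus_pow_pos (q : R) (n : nat) : Rabs q < 1 -> 0 < 1 + q ^ n.
Proof.
  intros Hq. destruct n. simpl; lra.
  apply (pow_abs_lt_1 q n) in Hq. apply Rabs_def2 in Hq. lra.
Qed.

Lemma gauss_prod_pos (q : R) (n : nat) : Rabs q < 1 -> 0 < gauss_prod q n.
Proof.
  intros Hq. induction n as [|n IH]; cbn [gauss_prod]. lra.
  apply Rmult_lt_0_compat; auto. apply Rdiv_lt_0_compat.
  now apply one_minus_pow_pos. now apply one_plus_pow_pos.
Qed.

(** Summand of a finite form of Gauss' identity. At [s = 0] it is [gauss_prod q n] itself, because 2
    / (1 + q^0) = 1; the terms with [s >= 1] are therefore the exact error between product and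
    series. *)
Definition gauss_term (q : R) (n s : nat) : R :=
  (-1) ^ s * q ^ (s * S n) * (gauss_prod q n / gauss_prod q s) * (2 / (1 + q ^ s)).

(* The differences telescope, with the right-hand side as primitive in [j]. *)
Lemma gauss_term_telescope (q : R) (n j : nat) : Rabs q < 1 ->
  sum_f_R0 (fun s => gauss_term q (S n) s - gauss_term q n s) j =
  2 * gauss_prod q n / (1 + q ^ S n) * ((-1) ^ S j * q ^ (S j * S n) / gauss_prod q j).
Proof.
  intros Hq. assert (Hn := one_plus_pow_pos q (S n) Hq).
  induction j as [|j IH].
  - unfold gauss_term. cbn [sum_f_R0 gauss_prod]. rewrite !Nat.mul_0_l, Nat.mul_1_l.
    change (q ^ 0) with 1. change ((-1)^1) with (-1 * 1). change ((-1)^0) with 1. field. lra.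
  - rewrite tech5, IH. clear IH. unfold gauss_term.
    assert (Hj := one_plus_pow_pos q (S j) Hq).
    assert (Hj' := one_minus_pow_pos q j Hq).
    assert (G := gauss_prod_pos q j Hq).
    replace (S j * S (S n))%nat with (S j * S n + S j)%nat by lia.
    replace (S (S j) * S n)%nat with (S j * S n + S n)%nat by lia.
    rewrite !pow_add. change ((-1) ^ S (S j)) with (-1 * (-1) ^ S j).
    cbn [gauss_prod].
    set (X := q ^ S j) in *. set (Y := q ^ S n) in *. set (Z := q ^ (S j * S n)).
    set (e := (-1) ^ S j). field. repeat split; lra.
Qed.

(** From [n] to [n + 1], put Y = q^(n+1). The change of the old terms telescopes to the new theta
    term times 1 / (1 + Y), and the additional summand [s = n + 1] is the new theta term times Y /
    (1 + Y). The two weights add up to 1. *)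
Lemma theta_partial_gauss (q : R) (n : nat) : Rabs q < 1 ->
  theta_partial q n = sum_f_R0 (gauss_term q n) n.
Proof.
  intros Hq. induction n as [|n IH].
  - unfold gauss_term; simpl; field.
  - rewrite tech5. cbn [theta_partial]. rewrite IH.
    assert (Hn := one_plus_pow_pos q (S n) Hq).
    assert (G := gauss_prod_pos q (S n) Hq).
    assert (G' := gauss_prod_pos q n Hq).
    assert (H := gauss_term_telescope q n n Hq).
    assert (E : sum_f_R0 (fun s => gauss_term q (S n) s - gauss_term q n s) n =
      sum_f_R0 (gauss_term q (S n)) n - sum_f_R0 (gauss_term q n) n) by apply minus_sum.
    rewrite E in H. clear E.
    replace (sum_f_R0 (gauss_term q (S n)) n) with
      (sum_f_R0 (gauss_term q n) n + 2 * gauss_prod q n / (1 + q ^ S n) *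
       ((-1) ^ S n * q ^ (S n * S n) / gauss_prod q n)) by lra.
    unfold gauss_term at 3.
    replace (S n * S (S n))%nat with (S n * S n + S n)%nat by lia.
    rewrite pow_add. set (Y := q ^ S n) in *. set (Z := q ^ (S n * S n)).
    field. repeat split; lra.
Qed.

(** A factor with x = r^j equals 1 / (1 + 2 x / (1 - x)), which is at least exp (- 2 x / (1 - r))
    since x <= r. Summing the exponents over j gives the bound with the extra factor [1 - r ^ n],
    the form in which the induction runs. *)
Lemma gauss_prod_lower (r : R) (n : nat) : 0 <= r < 1 ->
  exp (- (2 * r / (1 - r) ^ 2)) <= gauss_prod r n.
Proof.
  intros Hr.
  assert (A : forall n, exp (- (2 * r / (1 - r) ^ 2 * (1 - r ^ n))) <= gauss_prod r n).
  { clear n. assert (Hq : Rabs r < 1) by (rewrite Rabs_pos_eq; lra).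
    induction n as [|n IH].
    - simpl. replace (- _) with 0 by ring. rewrite exp_0; lra.
    - cbn [gauss_prod].
      replace (- (2 * r / (1 - r) ^ 2 * (1 - r ^ S n))) with
        (- (2 * r / (1 - r) ^ 2 * (1 - r ^ n)) + - (2 * r ^ S n / (1 - r)))
        by (simpl; field; lra).
      rewrite exp_plus. assert (P := one_minus_pow_pos r n Hq).
      assert (P' := one_plus_pow_pos r (S n) Hq).
      assert (R0 : 0 <= r ^ S n) by (apply pow_le; lra).
      assert (R1 : r ^ S n <= r).
      { simpl. assert (r ^ n <= 1). { rewrite <- (pow1 n). apply pow_incr. lra. }
        assert (0 <= r ^ n) by (apply pow_le; lra). nra. }
      apply Rmult_le_compat; auto; try (left; apply exp_pos).
      rewrite exp_Ropp.
      replace ((1 - r ^ S n) / (1 + r ^ S n)) with (/ (1 + 2 * r ^ S n / (1 - r ^ S n)))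
        by (field; lra).
      apply Rinv_le_contravar.
      assert (0 <= 2 * r ^ S n / (1 - r ^ S n)) by (apply Rdiv_le_0_compat; lra). lra.
      eapply Rle_trans. apply exp_ineq1_le.
      destruct (Req_dec (2 * r ^ S n / (1 - r ^ S n)) (2 * r ^ S n / (1 - r))) as [->|N]; [lra|].
      left; apply exp_increasing.
      assert (2 * r ^ S n / (1 - r ^ S n) <= 2 * r ^ S n / (1 - r)).
      { apply Rmult_le_compat_l. lra. apply Rinv_le_contravar; lra. }
      lra. }
  eapply Rle_trans; [|apply A].
  assert (0 <= 2 * r / (1 - r) ^ 2). { apply Rdiv_le_0_compat. lra. apply pow_lt; lra. }
  assert (0 <= r ^ n) by (apply pow_le; lra).
  assert (- (2 * r / (1 - r) ^ 2) <= - (2 * r / (1 - r) ^ 2 * (1 - r ^ n))) by nra.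
  destruct (Req_dec (- (2 * r / (1 - r) ^ 2)) (- (2 * r / (1 - r) ^ 2 * (1 - r ^ n)))) as [<-|N]; [lra|].
  left; apply exp_increasing. lra.
Qed.

Lemma gauss_factor_le (q : R) (n : nat) : Rabs q < 1 ->
  (1 - q ^ S n) / (1 + q ^ S n) <= / ((1 - Rabs q ^ S n) / (1 + Rabs q ^ S n)).
Proof.
  intros Hq. assert (P := pow_abs_lt_1 q n Hq). rewrite RPow_abs in *.
  assert (H0 := Rabs_pos (q ^ S n)).
  assert (- Rabs (q ^ S n) <= q ^ S n).
  { assert (H := Rle_abs (- q ^ S n)). rewrite Rabs_Ropp in H. lra. }
  set (z := q ^ S n) in *. set (w := Rabs z) in *.
  assert (0 < 1 + z) by lra.
  replace (/ ((1 - w) / (1 + w))) with ((1 + w) / (1 - w)) by (field; lra).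
  apply Rmult_le_reg_r with ((1 + z) * (1 - w)). nra.
  replace ((1 - z) / (1 + z) * ((1 + z) * (1 - w))) with ((1 - z) * (1 - w)) by (field; lra).
  replace ((1 + w) / (1 - w) * ((1 + z) * (1 - w))) with ((1 + w) * (1 + z)) by (field; lra).
  nra.
Qed.

Lemma gauss_prod_le_1 (r : R) (n : nat) : 0 <= r < 1 -> gauss_prod r n <= 1.
Proof.
  intros Hr. assert (Hq : Rabs r < 1) by (rewrite Rabs_pos_eq; lra).
  induction n as [|n IH]; cbn [gauss_prod]. lra.
  assert (G := gauss_prod_pos r n Hq).
  assert (P := one_minus_pow_pos r n Hq). assert (P' := one_plus_pow_pos r (S n) Hq).
  assert (R0 : 0 <= r ^ S n) by (apply pow_le; lra).
  assert ((1 - r ^ S n) / (1 + r ^ S n) <= 1).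
  { apply Rmult_le_reg_r with (1 + r ^ S n). lra. unfold Rdiv. rewrite Rmult_assoc, Rinv_l by lra. lra. }
  assert (0 < (1 - r ^ S n) / (1 + r ^ S n)) by (apply Rdiv_lt_0_compat; lra).
  nra.
Qed.

(** For negative [q] some factors exceed 1. Each is at most the inverse of the factor at [Rabs q],
    so quotients at [q] are controlled by products at [Rabs q], which stay between a positive
    constant and 1. *)
Lemma gauss_prod_ratio_le (q : R) (s d : nat) : Rabs q < 1 ->
  gauss_prod q (s + d) / gauss_prod q s <= gauss_prod (Rabs q) s / gauss_prod (Rabs q) (s + d).
Proof.
  intros Hq. assert (Hq' : Rabs (Rabs q) < 1) by (rewrite Rabs_Rabsolu; auto).
  induction d as [|d IH].
  - rewrite Nat.add_0_r. assert (G := gauss_prod_pos q s Hq).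
    assert (G' := gauss_prod_pos (Rabs q) s Hq'). right; field; lra.
  - rewrite Nat.add_succ_r. cbn [gauss_prod].
    assert (F := gauss_factor_le q (s + d) Hq).
    assert (G := gauss_prod_pos q s Hq). assert (G' := gauss_prod_pos (Rabs q) s Hq').
    assert (G2 := gauss_prod_pos q (s+d) Hq). assert (G2' := gauss_prod_pos (Rabs q) (s+d) Hq').
    assert (P1 := one_minus_pow_pos q (s+d) Hq). assert (P2 := one_plus_pow_pos q (S (s+d)) Hq).
    assert (P3 := one_minus_pow_pos _ (s+d) Hq'). assert (P4 := one_plus_pow_pos _ (S (s+d)) Hq').
    set (u := (1 - q ^ S (s + d)) / (1 + q ^ S (s + d))) in *.
    set (v := (1 - Rabs q ^ S (s + d)) / (1 + Rabs q ^ S (s + d))) in *.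
    assert (0 < u) by (apply Rdiv_lt_0_compat; lra).
    assert (0 < v) by (apply Rdiv_lt_0_compat; lra).
    replace (gauss_prod q (s + d) * u / gauss_prod q s) with (gauss_prod q (s + d) / gauss_prod q s * u)
      by (field; lra).
    replace (gauss_prod (Rabs q) s / (gauss_prod (Rabs q) (s + d) * v)) with
      (gauss_prod (Rabs q) s / gauss_prod (Rabs q) (s + d) * / v) by (field; lra).
    apply Rmult_le_compat; auto; try lra.
    left; apply Rdiv_lt_0_compat; lra.
Qed.

(* [theta_lim q] is the theta constant theta_4(q); theta_3(q) is [theta_lim (- q)]. *)
Definition theta_lim (q : R) : R := real (Lim_seq (gauss_prod q)).

Lemma geom_sum_le (x : R) (n : nat) : 0 <= x < 1 ->
  sum_f_R0 (fun s => x ^ S s) n <= x / (1 - x).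
Proof.
  intros Hx. rewrite (sum_eq _ (fun s => x ^ s * x)) by (intros; simpl; ring).
  rewrite <- scal_sum. rewrite tech3 by lra.
  assert (0 <= x ^ S n) by (apply pow_le; lra).
  unfold Rdiv. apply Rmult_le_compat_l. lra.
  rewrite <- (Rmult_1_l (/ (1 - x))) at 2. apply Rmult_le_compat_r.
  left; apply Rinv_0_lt_compat; lra. lra.
Qed.

(** The error consists of the terms [gauss_term q (S n) s] with [s >= 1]. Each contains q^(s (n+2))
    and otherwise bounded factors, so a geometric series dominates it. *)
Lemma theta_partial_minus_gauss_prod (q : R) : Rabs q < 1 ->
  exists C, 0 <= C /\
  forall n, Rabs (theta_partial q (S n) - gauss_prod q (S n)) <= C * Rabs q ^ S n.
Proof.
  intros Hq. set (r := Rabs q) in *. assert (Hr : 0 <= r < 1) by (split; [apply Rabs_pos|auto]).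
  assert (Hq' : Rabs r < 1) by (rewrite Rabs_pos_eq; lra).
  set (l := exp (- (2 * r / (1 - r) ^ 2))). assert (Hl : 0 < l) by apply exp_pos.
  (* [/ l] bounds the quotient of products, [2 / (1 - r)] bounds 2 / (1 + q^s), and the last factor
     comes from the geometric sum. *)
  exists (/ l * (2 / (1 - r)) * / (1 - r)). split.
  { apply Rmult_le_pos. apply Rmult_le_pos. left; now apply Rinv_0_lt_compat.
    apply Rdiv_le_0_compat; lra. left; apply Rinv_0_lt_compat; lra. }
  intros n. rewrite theta_partial_gauss by auto. rewrite decomp_sum by lia. cbn [Nat.pred].
  replace (gauss_term q (S n) 0) with (gauss_prod q (S n)).
  2:{ unfold gauss_term. rewrite Nat.mul_0_l. cbn [pow]. change (gauss_prod q 0) with 1. field. }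
  replace (_ + _ - _) with (sum_f_R0 (fun i => gauss_term q (S n) (S i)) n) by ring.
  eapply Rle_trans. apply sum_f_R0_triangle.
  eapply Rle_trans with (sum_f_R0 (fun s => (r ^ S (S n)) ^ S s * (/ l * (2 / (1 - r)))) n).
  { apply sum_Rle. intros s Hs. unfold gauss_term. rewrite !Rabs_mult.
    rewrite <- RPow_abs, Rabs_m1, pow1, Rmult_1_l.
    rewrite <- (RPow_abs q). fold r. rewrite (Nat.mul_comm (S s)), pow_mult, !Rmult_assoc.
    apply Rmult_le_compat_l. apply pow_le, pow_le; lra.
    assert (H := gauss_prod_ratio_le q (S s) (n - s) Hq).
    replace (S s + (n - s))%nat with (S n) in H by lia. fold r in H.
    assert (G := gauss_prod_pos q (S n) Hq). assert (G1 := gauss_prod_pos q (S s) Hq).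
    assert (G2 := gauss_prod_pos r (S n) Hq'). assert (G3 := gauss_prod_pos r (S s) Hq').
    assert (G4 := gauss_prod_le_1 r (S s) Hr).
    assert (G5 := gauss_prod_lower r (S n) Hr). fold l in G5.
    rewrite (Rabs_pos_eq (gauss_prod q (S n) / _)) by (left; apply Rdiv_lt_0_compat; lra).
    assert (P := one_plus_pow_pos q (S s) Hq).
    rewrite Rabs_pos_eq by (left; apply Rdiv_lt_0_compat; lra).
    apply Rmult_le_compat.
    left; apply Rdiv_lt_0_compat; lra. left; apply Rdiv_lt_0_compat; lra.
    - eapply Rle_trans. apply H. rewrite <- (Rmult_1_l (/ l)).
      apply Rmult_le_compat; try lra. left; now apply Rinv_0_lt_compat.
      apply Rinv_le_contravar; auto.
    - apply Rmult_le_compat_l. lra. apply Rinv_le_contravar. lra.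
      assert (Rabs (q ^ S s) <= r).
      { rewrite <- RPow_abs. fold r. simpl. assert (r ^ s <= 1).
        { rewrite <- (pow1 s). apply pow_incr. lra. }
        assert (0 <= r ^ s) by (apply pow_le; lra). nra. }
      assert (H1 := Rle_abs (- q ^ S s)). rewrite Rabs_Ropp in H1. lra. }
  rewrite <- scal_sum. 
  assert (Hx : 0 <= r ^ S (S n) <= r ^ S n).
  { simpl. assert (0 <= r ^ n) by (apply pow_le; lra). split; [apply Rmult_le_pos; nra|].
    assert (0 <= r * r ^ n) by nra. nra. }
  assert (Hx2 : r ^ S n <= r).
  { simpl. assert (r ^ n <= 1). { rewrite <- (pow1 n). apply pow_incr. lra. }
    assert (0 <= r ^ n) by (apply pow_le; lra). nra. }
  rewrite (Rmult_assoc (/ l * (2 / (1 - r)))). apply Rmult_le_compat_l.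
  { apply Rmult_le_pos. left; now apply Rinv_0_lt_compat. apply Rdiv_le_0_compat; lra. }
  eapply Rle_trans. apply geom_sum_le. lra.
  rewrite Rmult_comm. unfold Rdiv. apply Rmult_le_compat; try lra.
  left; apply Rinv_0_lt_compat; lra. apply Rinv_le_contravar; lra.
Qed.

(** [n * n] and [n] have the same parity. Hence the signs of the series disappear at [- q], which
    turns theta_4 into theta_3. *)
Lemma neg_pow_square (q : R) (n : nat) : (- q) ^ (n * n) = (-1) ^ n * q ^ (n * n).
Proof.
  replace (- q) with (-1 * q) by ring. rewrite Rpow_mult_distr. f_equal.
  destruct (Nat.Even_or_Odd n) as [[k E]|[k E]]; subst n.
  - replace (2 * k * (2 * k))%nat with (2 * (2 * k * k))%nat by lia. now rewrite !pow_1_even.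
  - replace ((2 * k + 1) * (2 * k + 1))%nat with (S (2 * (2 * k * k + 2 * k)))%nat by lia.
    replace (2 * k + 1)%nat with (S (2 * k)) by lia. now rewrite !pow_1_odd.
Qed.

Lemma pow_le_pow_exponent (r : R) (m n : nat) : 0 <= r <= 1 -> (m <= n)%nat -> r ^ n <= r ^ m.
Proof.
  intros Hr H. replace n with (m + (n - m))%nat by lia. rewrite pow_add.
  assert (r ^ (n - m) <= 1). { rewrite <- (pow1 (n - m)). apply pow_incr. lra. }
  assert (0 <= r ^ m) by (apply pow_le; lra). nra.
Qed.

Lemma theta_partial_near_1 (q : R) (n : nat) : Rabs q < 1 ->
  Rabs (theta_partial q n - 1) <= 2 * Rabs q / (1 - Rabs q).
Proof.
  intros Hq. assert (H0 := Rabs_pos q).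
  assert (A : Rabs (theta_partial q n - 1) <= 2 * Rabs q * (1 - Rabs q ^ n) / (1 - Rabs q)).
  { induction n as [|n IH]; cbn [theta_partial].
    - replace (1 - 1) with 0 by ring. rewrite Rabs_R0. simpl. right; field. lra.
    - replace (_ + _ - 1) with (theta_partial q n - 1 + 2 * (-1) ^ S n * q ^ (S n * S n)) by ring.
      eapply Rle_trans. apply Rabs_triang.
      rewrite !Rabs_mult, <- (RPow_abs (-1)), Rabs_m1, pow1, (Rabs_pos_eq 2), <- RPow_abs by lra.
      assert (Rabs q ^ (S n * S n) <= Rabs q ^ S n) by (apply pow_le_pow_exponent; [lra|nia]).
      replace (2 * Rabs q * (1 - Rabs q ^ S n) / (1 - Rabs q)) with
        (2 * Rabs q * (1 - Rabs q ^ n) / (1 - Rabs q) + 2 * Rabs q ^ S n) by (simpl; field; lra).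
      lra. }
  eapply Rle_trans. apply A. apply Rmult_le_compat_r. left; apply Rinv_0_lt_compat; lra.
  assert (0 <= Rabs q ^ n) by (apply pow_le; lra). nra.
Qed.

Lemma ex_lim_theta_partial (q : R) : Rabs q < 1 -> ex_finite_lim_seq (theta_partial q).
Proof.
  intros Hq. assert (H0 := Rabs_pos q).
  set (a := fun n => match n with O => 1 | S j => 2 * (-1) ^ S j * q ^ (S j * S j) end).
  assert (Hs : ex_series a).
  { apply (@ex_series_le R_AbsRing R_CompleteNormedModule) with (fun n => 2 * Rabs q ^ n).
    - intros n. change (norm (a n)) with (Rabs (a n)). destruct n as [|n]; cbn [a].
      + rewrite Rabs_R1. simpl. lra.
      + rewrite !Rabs_mult, <- (RPow_abs (-1)), Rabs_m1, pow1, (Rabs_pos_eq 2), <- RPow_abs by lra.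
        assert (Rabs q ^ (S n * S n) <= Rabs q ^ S n) by (apply pow_le_pow_exponent; [lra|nia]).
        lra.
    - apply (@ex_series_scal R_AbsRing). apply ex_series_geom. now rewrite Rabs_Rabsolu. }
  destruct Hs as [l Hl]. exists l.
  apply is_lim_seq_ext with (sum_n a); [|exact Hl].
  induction n as [|n IH]. now rewrite sum_O.
  rewrite sum_Sn, IH. reflexivity.
Qed.

Lemma is_lim_gauss_theta (q : R) : Rabs q < 1 ->
  is_lim_seq (gauss_prod q) (theta_lim q) /\ is_lim_seq (theta_partial q) (theta_lim q).
Proof.
  intros Hq. destruct (ex_lim_theta_partial q Hq) as [l Hl].
  assert (Hg : is_lim_seq (gauss_prod q) l).
  { apply is_lim_seq_incr_1. apply is_lim_seq_incr_1 in Hl.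
    replace (Finite l) with (Rbar_minus l 0) by (simpl; f_equal; ring).
    apply is_lim_seq_ext with (fun n => theta_partial q (S n) - (theta_partial q (S n) - gauss_prod q (S n))).
    intros; ring. apply is_lim_seq_minus'; auto.
    apply is_lim_seq_abs_0.
    destruct (theta_partial_minus_gauss_prod q Hq) as (C & HC & HB).
    apply is_lim_seq_le_le with (fun _ => 0) (fun n => C * Rabs q ^ S n).
    intros n; split; [apply Rabs_pos|apply HB].
    apply is_lim_seq_const.
    replace (Finite 0) with (Rbar_mult C 0) by (simpl; f_equal; ring).
    apply is_lim_seq_scal_l. apply is_lim_seq_incr_1 with (u := fun n => Rabs q ^ n).
    apply is_lim_seq_geom. now rewrite Rabs_Rabsolu. }
  unfold theta_lim. rewrite (is_lim_seq_unique _ _ Hg). split; auto.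
Qed.

Lemma theta_lim_near_1 (q : R) : Rabs q < 1 ->
  Rabs (theta_lim q - 1) <= 2 * Rabs q / (1 - Rabs q).
Proof.
  intros Hq. destruct (is_lim_gauss_theta q Hq) as [_ H].
  assert (L : is_lim_seq (fun n => Rabs (theta_partial q n - 1)) (Rabs (theta_lim q - 1))).
  { apply (is_lim_seq_abs _ (theta_lim q - 1)). apply is_lim_seq_minus'; auto. apply is_lim_seq_const. }
  refine (is_lim_seq_le _ _ _ _ _ L (is_lim_seq_const _)).
  intros n. now apply theta_partial_near_1.
Qed.

Lemma theta_lim_pos (r : R) : 0 <= r < 1 -> 0 < theta_lim r <= 1.
Proof.
  intros Hr. assert (Hq : Rabs r < 1) by (rewrite Rabs_pos_eq; lra).
  destruct (is_lim_gauss_theta r Hq) as [H _]. split.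
  - eapply Rlt_le_trans. apply (exp_pos (- (2 * r / (1 - r) ^ 2))).
    refine (is_lim_seq_le _ _ _ _ _ (is_lim_seq_const _) H). intros n. now apply gauss_prod_lower.
  - refine (is_lim_seq_le _ _ _ _ _ H (is_lim_seq_const _)). intros n. now apply gauss_prod_le_1.
Qed.

Lemma theta_partial_neg_ge_1 (p : R) (n : nat) : 0 <= p -> 1 <= theta_partial (- p) n.
Proof.
  intros Hp. induction n as [|n IH]; cbn [theta_partial]. lra.
  rewrite neg_pow_square.
  replace (2 * (-1) ^ S n * ((-1) ^ S n * p ^ (S n * S n))) with
    (2 * ((-1) ^ S n * (-1) ^ S n) * p ^ (S n * S n)) by ring.
  rewrite <- Rpow_mult_distr. replace (-1 * -1) with 1 by ring. rewrite pow1.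
  assert (0 <= p ^ (S n * S n)) by (apply pow_le; lra). lra.
Qed.

Lemma theta_lim_neg_ge_1 (p : R) : 0 <= p < 1 -> 1 <= theta_lim (- p).
Proof.
  intros Hp. assert (Hq : Rabs (- p) < 1) by (rewrite Rabs_Ropp, Rabs_pos_eq; lra).
  destruct (is_lim_gauss_theta _ Hq) as [_ H].
  refine (is_lim_seq_le _ _ _ _ _ (is_lim_seq_const _) H). intros n.
  apply theta_partial_neg_ge_1; lra.
Qed.

(** The even terms of theta_3 and theta_4 cancel and the odd ones add up; the first of these already
    gives [4 * p]. This keeps theta_2 away from 0, with a rate in [p] sharp enough for its
    logarithm. *)
Lemma theta_partial_diff_ge (p : R) (n : nat) : 0 <= p ->
  4 * p <= theta_partial (- p) (S n) - theta_partial p (S n).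
Proof.
  intros Hp. induction n as [|n IH]. simpl; lra.
  cbn [theta_partial] in *. rewrite (neg_pow_square p (S (S n))).
  replace (2 * (-1) ^ S (S n) * ((-1) ^ S (S n) * p ^ (S (S n) * S (S n)))) with
    (2 * ((-1) ^ S (S n) * (-1) ^ S (S n)) * p ^ (S (S n) * S (S n))) by ring.
  rewrite <- Rpow_mult_distr. replace (-1 * -1) with 1 by ring. rewrite pow1.
  assert (0 <= p ^ (S (S n) * S (S n))) by (apply pow_le; lra).
  assert ((-1) ^ S (S n) <= 1).
  { eapply Rle_trans. apply Rle_abs. rewrite <- RPow_abs, Rabs_m1, pow1. lra. }
  nra.
Qed.

Lemma theta_lim_diff_ge (p : R) : 0 <= p < 1 -> 4 * p <= theta_lim (- p) - theta_lim p.
Proof.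
  intros Hp. assert (Hq : Rabs p < 1) by (rewrite Rabs_pos_eq; lra).
  assert (Hq' : Rabs (- p) < 1) by now rewrite Rabs_Ropp.
  destruct (is_lim_gauss_theta _ Hq) as [_ H]. destruct (is_lim_gauss_theta _ Hq') as [_ H'].
  apply is_lim_seq_incr_1 in H. apply is_lim_seq_incr_1 in H'.
  refine (is_lim_seq_le _ _ _ _ _ (is_lim_seq_const _) (is_lim_seq_minus' _ _ _ _ H' H)).
  intros n. now apply theta_partial_diff_ge.
Qed.

(** * Theta identities under squaring of the nome *)

(** In the product of the factors at [q] and [- q], those with odd exponent cancel, and those with
    even exponent occur twice and are the factors at [q ^ 2]. *)
Lemma theta_lim_mul (q : R) : Rabs q < 1 ->
  theta_lim q * theta_lim (- q) = theta_lim (q ^ 2) ^ 2.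
Proof.
  intros Hq.
  assert (Hq' : Rabs (- q) < 1) by now rewrite Rabs_Ropp.
  assert (Hq2 : Rabs (q ^ 2) < 1) by now apply pow_abs_lt_1.
  destruct (is_lim_gauss_theta _ Hq) as [H _]. destruct (is_lim_gauss_theta _ Hq') as [H' _].
  destruct (is_lim_gauss_theta _ Hq2) as [H2 _].
  assert (E : forall n, gauss_prod q (2 * n) * gauss_prod (- q) (2 * n) = gauss_prod (q ^ 2) n * gauss_prod (q ^ 2) n).
  { induction n as [|n IH]. simpl; ring.
    replace (2 * S n)%nat with (S (S (2 * n))) by lia. cbn [gauss_prod].
    assert (P1 := one_minus_pow_pos q (2 * n) Hq). assert (P2 := one_plus_pow_pos q (S (2 * n)) Hq).
    assert (P3 := one_minus_pow_pos (- q) (S (2 * n)) Hq'). assert (P4 := one_plus_pow_pos (- q) (S (S (2 * n))) Hq').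
    assert (X1 : (- q) ^ S (2 * n) = - q ^ S (2 * n)).
    { rewrite <- !tech_pow_Rmult, !pow_mult. replace ((- q) ^ 2) with (q ^ 2) by ring. ring. }
    assert (X2 : (- q) ^ S (S (2 * n)) = (q ^ 2) ^ S n).
    { replace (S (S (2 * n))) with (2 * S n)%nat by lia. rewrite pow_mult. f_equal. ring. }
    assert (X3 : q ^ S (S (2 * n)) = (q ^ 2) ^ S n).
    { replace (S (S (2 * n))) with (2 * S n)%nat by lia. now rewrite pow_mult. }
    rewrite X1, X3. rewrite X2 in *. set (Y := q ^ S (2 * n)) in *. set (Z := (q ^ 2) ^ S n) in *.
    replace (gauss_prod q (2 * n) * ((1 - Y) / (1 + Y)) * ((1 - Z) / (1 + Z)) *
      (gauss_prod (- q) (2 * n) * ((1 - - Y) / (1 + - Y)) * ((1 - Z) / (1 + Z)))) with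
      (gauss_prod q (2 * n) * gauss_prod (- q) (2 * n) * ((1 - Z) / (1 + Z)) * ((1 - Z) / (1 + Z)))
      by (field; lra).
    rewrite IH. ring. }
  assert (A : is_lim_seq (fun n => gauss_prod q (2 * n) * gauss_prod (- q) (2 * n)) (theta_lim q * theta_lim (- q))).
  { apply is_lim_seq_mult'.
    - apply (is_lim_seq_subseq (gauss_prod q) (theta_lim q) (fun n => (2 * n)%nat)); auto.
      apply eventually_subseq. intros; lia.
    - apply (is_lim_seq_subseq (gauss_prod (- q)) (theta_lim (- q)) (fun n => (2 * n)%nat)); auto.
      apply eventually_subseq. intros; lia. }
  assert (B := is_lim_seq_mult' _ _ _ _ H2 H2).
  apply is_lim_seq_ext with (v := fun n => gauss_prod (q ^ 2) n * gauss_prod (q ^ 2) n) in A; auto.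
  assert (U1 := is_lim_seq_unique _ _ A). assert (U2 := is_lim_seq_unique _ _ B).
  rewrite U1 in U2. apply Rbar_finite_eq in U2. rewrite U2. ring.
Qed.

(** The odd terms of the two series cancel; the even ones have exponents (2 j)^2 = 4 j^2 and form
    the theta_3 series at q^4. *)
Lemma theta_lim_add (q : R) : Rabs q < 1 ->
  theta_lim q + theta_lim (- q) = 2 * theta_lim (- q ^ 4).
Proof.
  intros Hq.
  assert (Hq' : Rabs (- q) < 1) by now rewrite Rabs_Ropp.
  assert (Hq4 : Rabs (- q ^ 4) < 1) by (rewrite Rabs_Ropp; now apply pow_abs_lt_1).
  destruct (is_lim_gauss_theta _ Hq) as [_ H]. destruct (is_lim_gauss_theta _ Hq') as [_ H'].
  destruct (is_lim_gauss_theta _ Hq4) as [_ H4].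
  assert (E : forall n, theta_partial q (2 * n) + theta_partial (- q) (2 * n) = 2 * theta_partial (- q ^ 4) n).
  { induction n as [|n IH]. simpl; ring.
    replace (2 * S n)%nat with (S (S (2 * n))) by lia. cbn [theta_partial].
    rewrite !neg_pow_square.
    replace (S (S (2 * n))) with (2 * S n)%nat by lia.
    rewrite pow_1_even, pow_1_odd. rewrite <- (pow_mult q 4).
    replace (2 * S n * (2 * S n))%nat with (4 * (S n * S n))%nat by lia.
    assert (X : (-1) ^ S n * (-1) ^ S n = 1).
    { rewrite <- Rpow_mult_distr. replace (-1 * -1) with 1 by ring. apply pow1. }
    replace (2 * (-1) ^ S n * ((-1) ^ S n * q ^ (4 * (S n * S n)))) with
      (2 * ((-1) ^ S n * (-1) ^ S n) * q ^ (4 * (S n * S n))) by ring.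
    rewrite X. lra. }
  assert (A : is_lim_seq (fun n => theta_partial q (2 * n) + theta_partial (- q) (2 * n)) (theta_lim q + theta_lim (- q))).
  { apply is_lim_seq_plus'.
    - apply (is_lim_seq_subseq (theta_partial q) (theta_lim q) (fun n => (2 * n)%nat)); auto.
      apply eventually_subseq. intros; lia.
    - apply (is_lim_seq_subseq (theta_partial (- q)) (theta_lim (- q)) (fun n => (2 * n)%nat)); auto.
      apply eventually_subseq. intros; lia. }
  assert (B := is_lim_seq_scal_l _ 2 _ H4).
  apply is_lim_seq_ext with (v := fun n => 2 * theta_partial (- q ^ 4) n) in A; auto.
  assert (U1 := is_lim_seq_unique _ _ A). assert (U2 := is_lim_seq_unique _ _ B).
  rewrite U1 in U2. apply Rbar_finite_eq in U2. exact U2.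
Qed.

(** The error in theta_3^2 + theta_4^2 = 2 theta_3(q^2)^2. Expanding (theta_3 + theta_4)^2 with the
    sum and product formulas shows that the error at [q] is -2 times the error at [q ^ 2]. *)
Definition theta_defect (q : R) : R :=
  theta_lim q ^ 2 + theta_lim (- q) ^ 2 - 2 * theta_lim (- q ^ 2) ^ 2.

Lemma theta_defect_double (q : R) : Rabs q < 1 -> theta_defect q = -2 * theta_defect (q ^ 2).
Proof.
  intros Hq. assert (Hq2 : Rabs (q ^ 2) < 1) by now apply pow_abs_lt_1.
  assert (A := theta_lim_add q Hq). assert (M := theta_lim_mul q Hq).
  unfold theta_defect. replace ((q ^ 2) ^ 2) with (q ^ 4) by ring.
  replace (theta_lim q ^ 2 + theta_lim (- q) ^ 2) with
    ((theta_lim q + theta_lim (- q)) ^ 2 - 2 * (theta_lim q * theta_lim (- q))) by ring.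
  rewrite A, M. ring.
Qed.

Lemma theta_defect_small (q : R) : Rabs q <= / 4 -> Rabs (theta_defect q) <= 50 * Rabs q.
Proof.
  intros Hq. assert (H0 := Rabs_pos q).
  (* 12 = 3 * 4 from |theta - 1| <= 3 |q| and |theta + 1| <= 4; the defect then costs 12 + 12 + 24
     <= 50. *)
  assert (B : forall p, Rabs p <= Rabs q -> Rabs (theta_lim p ^ 2 - 1) <= 12 * Rabs q).
  { intros p Hp. assert (Hp1 : Rabs p < 1) by lra. assert (Hpp := Rabs_pos p).
    assert (H := theta_lim_near_1 p Hp1).
    assert (2 * Rabs p / (1 - Rabs p) <= 3 * Rabs q).
    { apply Rmult_le_reg_r with (1 - Rabs p). lra. unfold Rdiv. rewrite Rmult_assoc, Rinv_l by lra. nra. }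
    replace (theta_lim p ^ 2 - 1) with ((theta_lim p - 1) * (theta_lim p + 1)) by ring.
    rewrite Rabs_mult. assert (Rabs (theta_lim p + 1) <= 4).
    { replace (theta_lim p + 1) with ((theta_lim p - 1) + 2) by ring.
      eapply Rle_trans. apply Rabs_triang. rewrite (Rabs_pos_eq 2); lra. }
    assert (U := Rabs_pos (theta_lim p - 1)). assert (U2 := Rabs_pos (theta_lim p + 1)). nra. }
  assert (B1 := B q (Rle_refl _)).
  assert (B2 := B (- q)). rewrite Rabs_Ropp in B2. specialize (B2 (Rle_refl _)).
  assert (B3 := B (- q ^ 2)). rewrite Rabs_Ropp, <- RPow_abs in B3.
  assert (B4 : Rabs q ^ 2 <= Rabs q) by nra. specialize (B3 B4).
  unfold theta_defect. apply Rabs_le.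
  apply Rabs_le_between in B1. apply Rabs_le_between in B2. apply Rabs_le_between in B3. lra.
Qed.

(** One doubling step loses a factor 2, but the linear bound at [q ^ 2] gains |q| <= 1/4. Each
    iteration thus halves the bound. *)
Lemma theta_defect_small_0 (q : R) : Rabs q <= / 4 -> theta_defect q = 0.
Proof.
  intros Hq.
  assert (A : forall n q, Rabs q <= / 4 -> Rabs (theta_defect q) <= 50 * (/ 2) ^ n * Rabs q).
  { induction n as [|n IH]; intros p Hp. simpl. rewrite Rmult_1_r. now apply theta_defect_small.
    assert (H0 := Rabs_pos p).
    rewrite theta_defect_double by lra. rewrite Rabs_mult.
    replace (Rabs (-2)) with 2 by (rewrite Rabs_left; lra).
    assert (X : Rabs (p ^ 2) <= / 4 * Rabs p) by (rewrite <- RPow_abs; nra).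
    assert (Y := IH (p ^ 2)).
    assert (Rabs (p ^ 2) <= / 4) by lra. specialize (Y H). simpl pow at 1.
    change ((/ 2) ^ S n) with (/ 2 * (/ 2) ^ n).
    assert (0 <= (/ 2) ^ n) by (apply pow_le; lra). simpl pow in *. nra. }
  assert (L : is_lim_seq (fun n => 50 * (/ 2) ^ n * Rabs q) 0).
  { replace (Finite 0) with (Rbar_mult (Rbar_mult 50 0) (Rabs q)) by (simpl; f_equal; ring).
    apply is_lim_seq_scal_r. apply is_lim_seq_scal_l. apply is_lim_seq_geom. rewrite Rabs_pos_eq; lra. }
  assert (H : Rbar_le (Rabs (theta_defect q)) 0).
  { refine (is_lim_seq_le _ _ _ _ _ (is_lim_seq_const _) L). intros n. now apply A. }
  simpl in H. assert (H0 := Rabs_pos (theta_defect q)).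
  destruct (Req_dec (theta_defect q) 0) as [E|N]; auto. apply Rabs_pos_lt in N. lra.
Qed.

(* A property inherited by [q] from [q ^ 2] spreads from a neighbourhood of 0 to the unit interval. *)
Lemma square_descent (P : R -> Prop) (d : R) : 0 < d ->
  (forall q, Rabs q <= d -> P q) -> (forall q, Rabs q < 1 -> P (q ^ 2) -> P q) ->
  forall q, Rabs q < 1 -> P q.
Proof.
  intros Hd H0 H1 q Hq.
  assert (L : is_lim_seq (fun n => Rabs q ^ n) 0) by (apply is_lim_seq_geom; now rewrite Rabs_Rabsolu).
  apply is_lim_seq_spec in L. destruct (L (mkposreal d Hd)) as [N HN]. simpl in HN.
  assert (HN' : Rabs (q ^ (2 ^ N)) <= d).
  { specialize (HN (2 ^ N)%nat). rewrite Rminus_0_r, RPow_abs, Rabs_Rabsolu in HN.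
    left; apply HN. assert (X := Nat.pow_gt_lin_r 2 N). lia. }
  clear HN L. revert q Hq HN'. induction N as [|N IH]; intros q Hq HN.
  - apply H0. simpl in HN. now rewrite Rmult_1_r in HN.
  - apply H1; auto. apply IH. now apply pow_abs_lt_1. rewrite <- pow_mult. exact HN.
Qed.

Lemma theta_lim_sqr_add (q : R) : Rabs q < 1 ->
  theta_lim q ^ 2 + theta_lim (- q) ^ 2 = 2 * theta_lim (- q ^ 2) ^ 2.
Proof.
  intros Hq. enough (theta_defect q = 0) by (unfold theta_defect in H; lra).
  revert q Hq. apply square_descent with (/ 4). lra. apply theta_defect_small_0.
  intros q Hq H. rewrite theta_defect_double, H by auto. ring.
Qed.

(** * Gauss' integral and Landen's transformation *)

Definition quad (a b p : R) : R := a ^ 2 * cos p ^ 2 + b ^ 2 * sin p ^ 2.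

(** For positive arguments this is PI / 2 divided by the arithmetic-geometric mean. The mean itself
    is never formed; its role is played by invariance under one step. *)
Definition agm_int (a b : R) : R := RInt (fun p => / sqrt (quad a b p)) 0 (PI / 2).

Lemma sin2_add_cos2 (p : R) : sin p ^ 2 + cos p ^ 2 = 1.
Proof. assert (H := sin2_cos2 p). unfold Rsqr in H. lra. Qed.

Lemma weighted_cos2_sin2_pos (u v p : R) : 0 < u -> 0 < v -> 0 < u * cos p ^ 2 + v * sin p ^ 2.
Proof.
  intros Hu Hv. assert (H := sin2_add_cos2 p).
  assert (H1 := pow2_ge_0 (sin p)). assert (H2 := pow2_ge_0 (cos p)).
  destruct (Rle_lt_dec u v); nra.
Qed.

Lemma quad_pos (a b p : R) : 0 < a -> 0 < b -> 0 < quad a b p.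
Proof. intros. apply weighted_cos2_sin2_pos; apply pow_lt; auto. Qed.

Lemma continuous_inv_sqrt_quad (a b p : R) : 0 < a -> 0 < b ->
  continuous (fun p => / sqrt (quad a b p)) p.
Proof.
  intros Ha Hb. assert (H := quad_pos a b p Ha Hb).
  apply (ex_derive_continuous (fun p => / sqrt (quad a b p))). unfold quad in *. auto_derive.
  repeat split; auto. now apply Rgt_not_eq, sqrt_lt_R0.
Qed.

Lemma ex_RInt_inv_sqrt_quad (a b u v : R) : 0 < a -> 0 < b ->
  ex_RInt (fun p => / sqrt (quad a b p)) u v.
Proof. intros. apply (ex_RInt_continuous (V := R_CompleteNormedModule)). intros. now apply continuous_inv_sqrt_quad. Qed.

Lemma RInt_Rmult_l (f : R -> R) (k a b : R) : ex_RInt f a b ->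
  RInt (fun x => k * f x) a b = k * RInt f a b.
Proof. exact (@RInt_scal R_CompleteNormedModule f a b k). Qed.

(** Landen's substitution maps [0, PI / 2] onto [0, PI], so the transformed integral appears over
    the double range; the reflection p -> PI - p folds it back. *)
Lemma agm_int_full (a b : R) : 0 < a -> 0 < b ->
  RInt (fun p => / sqrt (quad a b p)) 0 PI = 2 * agm_int a b.
Proof.
  intros Ha Hb. set (f := fun p => / sqrt (quad a b p)).
  assert (C : RInt f 0 (PI / 2) + RInt f (PI / 2) PI = RInt f 0 PI).
  { apply (RInt_Chasles f); now apply ex_RInt_inv_sqrt_quad. }
  assert (L : RInt (fun y => scal (-1) (f (-1 * y + PI))) 0 (PI / 2) = RInt f (-1 * 0 + PI) (-1 * (PI / 2) + PI)).
  { apply (RInt_comp_lin f). now apply ex_RInt_inv_sqrt_quad. }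
  replace (-1 * 0 + PI) with PI in L by ring. replace (-1 * (PI / 2) + PI) with (PI / 2) in L by field.
  rewrite (RInt_ext _ (fun y => -1 * f y)) in L.
  2:{ intros y _. change (scal (-1) (f (-1 * y + PI))) with (-1 * f (-1 * y + PI)). unfold f, quad. f_equal. replace (-1 * y + PI) with (PI - y) by ring.
      rewrite sin_PI_x. replace (PI - y) with (- y + PI) by ring. rewrite neg_cos, cos_neg.
      replace ((- cos y) ^ 2) with (cos y ^ 2) by ring. reflexivity. }
  rewrite RInt_Rmult_l in L by now apply ex_RInt_inv_sqrt_quad.
  assert (S : - RInt f (PI / 2) PI = RInt f PI (PI / 2)).
  { apply (opp_RInt_swap f). now apply ex_RInt_inv_sqrt_quad. }
  unfold agm_int. fold f. lra.
Qed.

Section Landen.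

Variables a b : R.
Hypothesis Ha : 0 < a.
Hypothesis Hb : 0 < b.

Let N (p : R) : R := a * cos p ^ 2 + b * sin p ^ 2.
Let z (p : R) : R := (a - b) * (sin p * cos p) / N p.

(** The classical angle p + arctan ((b / a) tan p). Subtracting it from 2 p and applying the
    addition theorem of the tangent yields a denominator that never vanishes, so the formula is
    smooth through PI / 2. *)
Definition landen_subst (p : R) : R := 2 * p - atan ((a - b) * (sin p * cos p) / (a * cos p ^ 2 + b * sin p ^ 2)).

Let N_pos (p : R) : 0 < N p.
Proof. now apply weighted_cos2_sin2_pos. Qed.

Let one_plus_z2 (p : R) : 1 + z p ^ 2 = quad a b p / N p ^ 2.
Proof.
  assert (H := N_pos p). assert (E := sin2_add_cos2 p).
  replace (1 + z p ^ 2) with ((N p ^ 2 + (a - b) ^ 2 * (sin p * cos p) ^ 2) / N p ^ 2) by (unfold z; field; lra).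
  f_equal. unfold N, quad.
  replace (_ + _) with ((a ^ 2 * cos p ^ 2 + b ^ 2 * sin p ^ 2) * (sin p ^ 2 + cos p ^ 2)) by ring.
  rewrite E. ring.
Qed.

Let landen_cos_numerator (p : R) :
  (cos p ^ 2 - sin p ^ 2) * N p + 2 * (a - b) * (sin p ^ 2 * cos p ^ 2) = a * cos p ^ 2 - b * sin p ^ 2.
Proof.
  assert (E := sin2_add_cos2 p). unfold N.
  replace (_ + _) with ((a * cos p ^ 2 - b * sin p ^ 2) * (sin p ^ 2 + cos p ^ 2)) by ring.
  rewrite E. ring.
Qed.

Let landen_sin_numerator (p : R) : 2 * N p - (a - b) * (cos p ^ 2 - sin p ^ 2) = a + b.
Proof.
  assert (E := sin2_add_cos2 p). unfold N.
  replace (_ - _) with ((a + b) * (sin p ^ 2 + cos p ^ 2)) by ring.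
  rewrite E. ring.
Qed.

Lemma is_derive_landen_subst (p : R) :
  is_derive landen_subst p ((a + b) * (a * cos p ^ 2 + b * sin p ^ 2) / quad a b p).
Proof.
  assert (H := N_pos p). assert (Q := quad_pos a b p Ha Hb).
  assert (Z : is_derive z p ((a - b) * (a * cos p ^ 2 - b * sin p ^ 2) / N p ^ 2)).
  { rewrite <- landen_cos_numerator. unfold z. 
    assert (Hn : N p <> 0) by lra. unfold N in *. auto_derive. exact Hn.
    field. repeat split; lra. }
  assert (A : is_derive (fun p => 2 * p - atan (z p)) p
    (2 - ((a - b) * (a * cos p ^ 2 - b * sin p ^ 2) / N p ^ 2) * (/ (1 + z p ^ 2)))).
  { apply (is_derive_minus (fun p => 2 * p) (fun p => atan (z p))). auto_derive; auto; ring.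
    apply (is_derive_comp atan z); auto. apply is_derive_Reals.
    apply derivable_pt_lim_atan. }
  rewrite one_plus_z2 in A.
  replace ((a + b) * (a * cos p ^ 2 + b * sin p ^ 2) / quad a b p) with
    (2 - (a - b) * (a * cos p ^ 2 - b * sin p ^ 2) / N p ^ 2 * / (quad a b p / N p ^ 2)).
  exact A.
  assert (E := sin2_add_cos2 p).
  replace ((a + b) * (a * cos p ^ 2 + b * sin p ^ 2)) with
    (2 * quad a b p - (a - b) * (a * cos p ^ 2 - b * sin p ^ 2)) by (unfold quad; ring).
  field. split; lra.
Qed.

(** Cosine and sine of the new angle are rational in sin p and cos p up to the common factor w = cos
    (atan z), and w^2 = N^2 / quad. The root of the new form then cancels against the derivative of
    the substitution, leaving 2 / sqrt (quad a b p). *)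
Lemma quad_landen_subst (p : R) :
  quad ((a + b) / 2) (sqrt (a * b)) (landen_subst p) =
  ((a + b) / 2 * (a * cos p ^ 2 + b * sin p ^ 2)) ^ 2 / quad a b p.
Proof.
  assert (H := N_pos p). assert (Q := quad_pos a b p Ha Hb). assert (E := sin2_add_cos2 p).
  set (w := cos (atan (z p))).
  assert (Hw : w ^ 2 = N p ^ 2 / quad a b p /\ sin (atan (z p)) = z p * w).
  { assert (W : 0 < w) by (assert (B := atan_bound (z p)); apply cos_gt_0; lra).
    assert (T := tan_atan (z p)). unfold tan in T. fold w in T.
    assert (S1 : sin (atan (z p)) = z p * w) by (rewrite <- T at 2; field; lra).
    split; auto.
    assert (E1 := sin2_add_cos2 (atan (z p))). fold w in E1. rewrite S1 in E1.
    assert (U : w ^ 2 * (1 + z p ^ 2) = 1) by lra. rewrite one_plus_z2 in U.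
    replace (N p ^ 2 / quad a b p) with ((w ^ 2 * (quad a b p / N p ^ 2)) * (N p ^ 2 / quad a b p))
      by (rewrite U; ring).
    field. lra. }
  destruct Hw as [Hw Hs].
  assert (Cs : cos (landen_subst p) = w * ((a * cos p ^ 2 - b * sin p ^ 2) / N p)).
  { unfold landen_subst. fold (N p). fold (z p). rewrite cos_minus, Hs. fold w.
    rewrite cos_2a, sin_2a. rewrite <- landen_cos_numerator. unfold z. field. lra. }
  assert (Sn : sin (landen_subst p) = w * ((a + b) * (sin p * cos p) / N p)).
  { unfold landen_subst. fold (N p). fold (z p). rewrite sin_minus, Hs. fold w.
    rewrite cos_2a, sin_2a. rewrite <- (landen_sin_numerator p). unfold z. field. lra. }
  unfold quad at 1. rewrite Cs, Sn.
  rewrite pow2_sqrt by (apply Rmult_le_pos; lra).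
  rewrite !(Rpow_mult_distr w), Hw. unfold N in *. field. lra.
Qed.

Lemma agm_int_step : agm_int a b = agm_int ((a + b) / 2) (sqrt (a * b)).
Proof.
  assert (Hm : 0 < (a + b) / 2) by lra.
  assert (Hg : 0 < sqrt (a * b)) by (apply sqrt_lt_R0, Rmult_lt_0_compat; auto).
  set (f := fun p => / sqrt (quad ((a + b) / 2) (sqrt (a * b)) p)).
  assert (I := is_RInt_comp f landen_subst (fun p => (a + b) * (a * cos p ^ 2 + b * sin p ^ 2) / quad a b p) 0 (PI / 2)).
  match type of I with _ -> _ -> ?G => assert (I' : G) end.
  { apply I.
    - intros p _. now apply continuous_inv_sqrt_quad.
    - intros p _. split. apply is_derive_landen_subst.
      apply (ex_derive_continuous (fun p => (a + b) * (a * cos p ^ 2 + b * sin p ^ 2) / quad a b p)).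
      assert (Q := quad_pos a b p Ha Hb). unfold quad in *. auto_derive. lra. }
  clear I.
  replace (landen_subst 0) with 0 in I'.
  2:{ unfold landen_subst. rewrite sin_0. replace ((a - b) * (0 * cos 0) / _) with 0 by (unfold Rdiv; ring).
      rewrite atan_0. ring. }
  replace (landen_subst (PI / 2)) with PI in I'.
  2:{ unfold landen_subst. rewrite cos_PI2. replace ((a - b) * (sin (PI/2) * 0) / _) with 0 by (unfold Rdiv; ring).
      rewrite atan_0. field. }
  unfold f in I' at 2. rewrite agm_int_full in I' by auto.
  apply is_RInt_unique in I'.
  rewrite (RInt_ext _ (fun p => 2 * / sqrt (quad a b p))) in I'.
  - rewrite RInt_Rmult_l in I' by now apply ex_RInt_inv_sqrt_quad.
    fold (agm_int a b) in I'. unfold scal in I'; simpl in I'. unfold mult in I'; simpl in I'. lra.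
  - intros p _. unfold f. rewrite quad_landen_subst.
    assert (H := N_pos p). unfold N in H. assert (Q := quad_pos a b p Ha Hb).
    assert (R1 := sqrt_lt_R0 _ Q). assert (R2 := sqrt_sqrt _ (Rlt_le _ _ Q)).
    match goal with |- scal ?x ?y = ?z => change (@eq R (x * y) z) end.
    rewrite sqrt_div_alt by auto. rewrite sqrt_pow2 by (apply Rmult_le_pos; lra).
    set (Nn := a * cos p ^ 2 + b * sin p ^ 2) in *.
    set (r := sqrt (quad a b p)) in *. rewrite <- R2. field. repeat split; lra.
Qed.

End Landen.

Lemma agm_int_homog (c a b : R) : 0 < c -> 0 < a -> 0 < b -> agm_int (c * a) (c * b) = agm_int a b / c.
Proof.
  intros Hc Ha Hb. unfold agm_int.
  rewrite (RInt_ext _ (fun p => / c * / sqrt (quad a b p))).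
  - rewrite RInt_Rmult_l by now apply ex_RInt_inv_sqrt_quad. field. lra.
  - intros p _. assert (Q := quad_pos a b p Ha Hb).
    replace (quad (c * a) (c * b) p) with (c ^ 2 * quad a b p) by (unfold quad; ring).
    rewrite sqrt_mult_alt by (apply pow2_ge_0). rewrite sqrt_pow2 by lra.
    assert (R1 := sqrt_lt_R0 _ Q). apply Rinv_mult.
Qed.

Lemma agm_int_bounds (a b : R) : 0 < b <= a -> PI / 2 / a <= agm_int a b <= PI / 2 / b.
Proof.
  intros [Hb Hab]. assert (Ha : 0 < a) by lra. assert (HP := PI_RGT_0).
  assert (C : forall c, RInt (fun _ => / c) 0 (PI / 2) = PI / 2 / c).
  { intros c. rewrite RInt_const. unfold scal; simpl; unfold mult; simpl. unfold Rdiv; ring. }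
  assert (B : forall p, b <= sqrt (quad a b p) <= a).
  { intros p. assert (E := sin2_add_cos2 p).
    assert (H1 := pow2_ge_0 (sin p)). assert (H2 := pow2_ge_0 (cos p)).
    assert (b ^ 2 <= a ^ 2) by (apply pow_incr; lra).
    replace b with (sqrt (b ^ 2)) at 1 by (apply sqrt_pow2; lra).
    replace a with (sqrt (a ^ 2)) at 3 by (apply sqrt_pow2; lra).
    split; apply sqrt_le_1_alt; unfold quad; nra. }
  rewrite <- !C. split; apply RInt_le; try lra; try apply ex_RInt_const; try now apply ex_RInt_inv_sqrt_quad.
  - intros p _. destruct (B p). apply Rinv_le_contravar; lra.
  - intros p _. destruct (B p). apply Rinv_le_contravar; lra.
Qed.

(** The logarithmic singularity for small [c]. With sin p in the numerator the integrand has the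
    elementary primitive [G], which produces the logarithm. The remainder (1 - sin p) / sqrt (quad)
    is at most 1 / a, since sqrt (quad) >= a cos p >= a (1 - sin p). *)
Lemma agm_int_log_bounds (a b c : R) : 0 < a -> 0 < b -> 0 < c -> a ^ 2 = b ^ 2 + c ^ 2 ->
  ln ((a + b) / c) / b <= agm_int a c <= ln ((a + b) / c) / b + PI / 2 / a.
Proof.
  intros Ha Hb Hc E. assert (HP := PI_RGT_0).
  assert (Q := fun p => quad_pos a c p Ha Hc).
  assert (Qe : forall p, quad a c p = c ^ 2 + b ^ 2 * cos p ^ 2).
  { intros p. assert (H := sin2_add_cos2 p). unfold quad. rewrite E.
    replace (sin p ^ 2) with (1 - cos p ^ 2) by lra. ring. }
  set (G := fun p => - ln (b * cos p + sqrt (quad a c p)) / b).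
  assert (S0 : forall p, 0 < sqrt (quad a c p)) by (intros; now apply sqrt_lt_R0).
  assert (P : forall p, 0 < b * cos p + sqrt (quad a c p)).
  { intros p. assert (H : Rabs (b * cos p) < sqrt (quad a c p)).
    { rewrite <- (sqrt_pow2 (Rabs _)) by apply Rabs_pos. apply sqrt_lt_1_alt.
      rewrite pow2_abs, Qe. split. apply pow2_ge_0. assert (0 < c ^ 2) by now apply pow_lt.
      rewrite Rpow_mult_distr. lra. }
    apply Rabs_def2 in H. lra. }
  assert (D : forall p, is_derive G p (sin p / sqrt (quad a c p))).
  { intros p. assert (Pp := P p). assert (Qp := Q p). assert (Sp := S0 p).
    unfold G. rewrite Qe in *. apply (is_derive_ext (fun p => - ln (b * cos p + sqrt (c ^ 2 + b ^ 2 * cos p ^ 2)) / b)).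
    intros t. now rewrite Qe. auto_derive. repeat split; auto.
    simpl in *. field. repeat split; lra. }
  assert (Cn : forall p, continuous (fun p => sin p / sqrt (quad a c p)) p).
  { intros p. apply (ex_derive_continuous (fun p => sin p / sqrt (quad a c p))).
    assert (Qp := Q p). assert (Sp := S0 p). unfold quad in *. auto_derive. repeat split; auto. now apply Rgt_not_eq. }
  assert (I : is_RInt (fun p => sin p / sqrt (quad a c p)) 0 (PI / 2) (G (PI / 2) - G 0)).
  { apply (is_RInt_derive G). intros; apply D. intros; apply Cn. }
  replace (G (PI / 2) - G 0) with (ln ((a + b) / c) / b) in I.
  2:{ unfold G. rewrite !Qe, cos_PI2, cos_0.
      replace (c ^ 2 + b ^ 2 * 0 ^ 2) with (c ^ 2) by ring.
      replace (c ^ 2 + b ^ 2 * 1 ^ 2) with (a ^ 2) by (rewrite E; ring).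
      rewrite !sqrt_pow2 by lra. rewrite Rmult_0_r, Rplus_0_l, Rmult_1_r, ln_div by lra.
      rewrite (Rplus_comm b a). field. lra. }
  assert (Ie : ex_RInt (fun p => sin p / sqrt (quad a c p)) 0 (PI / 2)) by (eexists; apply I).
  rewrite <- (is_RInt_unique (V := R_CompleteNormedModule) _ _ _ _ I).
  assert (J := ex_RInt_inv_sqrt_quad a c 0 (PI / 2) Ha Hc).
  split.
  - apply RInt_le; auto. lra. intros p _. assert (Sp := S0 p). assert (B := SIN_bound p).
    rewrite <- (Rmult_1_l (/ sqrt _)). apply Rmult_le_compat_r; try lra.
    left; now apply Rinv_0_lt_compat.
  - assert (C : RInt (fun _ => / a) 0 (PI / 2) = PI / 2 / a).
    { rewrite RInt_const. change (scal (PI / 2 - 0) (/ a)) with ((PI / 2 - 0) * / a). now rewrite Rminus_0_r. }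
    rewrite <- C.
    assert (Pl : RInt (fun p => sin p / sqrt (quad a c p) + / a) 0 (PI / 2) =
      RInt (fun p => sin p / sqrt (quad a c p)) 0 (PI / 2) + RInt (fun _ => / a) 0 (PI / 2)).
    { apply (RInt_plus (V := R_CompleteNormedModule)); auto. apply ex_RInt_const. }
    rewrite <- Pl. apply RInt_le; auto. lra.
    apply (ex_RInt_plus (V := R_NormedModule)); auto. apply ex_RInt_const.
    intros p Hp. assert (Sp := S0 p). assert (B := SIN_bound p). assert (T := sin2_add_cos2 p).
    assert (Sn : 0 <= sin p) by (apply sin_ge_0; lra).
    assert (H : a * (1 - sin p) <= sqrt (quad a c p)).
    { rewrite <- (sqrt_pow2 (a * (1 - sin p))) by (apply Rmult_le_pos; lra). apply sqrt_le_1_alt.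
      unfold quad. rewrite Rpow_mult_distr.
      assert ((1 - sin p) ^ 2 <= cos p ^ 2) by nra.
      assert (0 <= c ^ 2 * sin p ^ 2) by (apply Rmult_le_pos; apply pow2_ge_0).
      assert (0 <= a ^ 2) by apply pow2_ge_0. nra. }
    apply Rmult_le_reg_r with (a * sqrt (quad a c p)). now apply Rmult_lt_0_compat.
    set (S := sqrt (quad a c p)) in *.
    replace (/ S * (a * S)) with a by (field; lra).
    replace ((sin p / S + / a) * (a * S)) with (a * sin p + S) by (field; lra). lra.
Qed.

(** * Gauss' integral at theta constants *)

(* With a = theta_3^2, b = theta_4^2, c = theta_2^2 at the nome q, the AGM step is q -> q^2. *)
Definition theta_a (q : R) : R := theta_lim (- q) ^ 2.
Definition theta_b (q : R) : R := theta_lim q ^ 2.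
Definition theta_c (q : R) : R := sqrt (theta_a q ^ 2 - theta_b q ^ 2).

Lemma theta_ab_step (q : R) : 0 <= q < 1 ->
  theta_a (q ^ 2) = (theta_a q + theta_b q) / 2 /\ theta_b (q ^ 2) = sqrt (theta_a q * theta_b q).
Proof.
  intros Hq. assert (Hq' : Rabs q < 1) by (rewrite Rabs_pos_eq; lra).
  assert (S := theta_lim_sqr_add q Hq'). assert (M := theta_lim_mul q Hq').
  assert (P : 0 <= q ^ 2 < 1). { split. apply pow2_ge_0. nra. }
  assert (Pp := theta_lim_pos _ P).
  unfold theta_a, theta_b. split. lra.
  rewrite <- Rpow_mult_distr, (Rmult_comm (theta_lim (- q))), M.
  rewrite sqrt_pow2. reflexivity. apply pow2_ge_0.
Qed.

Lemma theta_ab_bounds (q : R) : 0 < q < 1 -> 0 < theta_b q <= 1 /\ 1 <= theta_a q /\ theta_b q < theta_a q.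
Proof.
  intros Hq. assert (Hq0 : 0 <= q < 1) by lra.
  assert (P := theta_lim_pos q Hq0). assert (N := theta_lim_neg_ge_1 q Hq0).
  assert (D := theta_lim_diff_ge q Hq0). unfold theta_a, theta_b. repeat split; nra.
Qed.

Lemma theta_c_pos (q : R) : 0 < q < 1 -> 0 < theta_c q.
Proof.
  intros Hq. destruct (theta_ab_bounds q Hq) as (B & A & L).
  apply sqrt_lt_R0. nra.
Qed.

Lemma theta_c_sqr (q : R) : 0 < q < 1 -> theta_c q ^ 2 = theta_a q ^ 2 - theta_b q ^ 2.
Proof.
  intros Hq. destruct (theta_ab_bounds q Hq) as (B & A & L).
  apply pow2_sqrt. nra.
Qed.

Lemma pow2_in_unit (q : R) : 0 < q < 1 -> 0 < q ^ 2 < 1.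
Proof. intros; nra. Qed.

Lemma theta_c_step (q : R) : 0 < q < 1 -> theta_c (q ^ 2) = (theta_a q - theta_b q) / 2.
Proof.
  intros Hq. assert (Hq2 := pow2_in_unit q Hq).
  destruct (theta_ab_bounds q Hq) as (B & A & L).
  assert (Hq0 : 0 <= q < 1) by lra.
  destruct (theta_ab_step q Hq0) as [E1 E2].
  unfold theta_c. rewrite E1, E2, pow2_sqrt by nra.
  replace (_ - _) with (((theta_a q - theta_b q) / 2) ^ 2) by field. apply sqrt_pow2. lra.
Qed.

Lemma agm_int_ab_step (q : R) : 0 < q < 1 ->
  agm_int (theta_a q) (theta_b q) = agm_int (theta_a (q ^ 2)) (theta_b (q ^ 2)).
Proof.
  intros Hq. destruct (theta_ab_bounds q Hq) as (B & A & L).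
  assert (Hq0 : 0 <= q < 1) by lra.
  destruct (theta_ab_step q Hq0) as [E1 E2]. rewrite E1, E2. apply agm_int_step; lra.
Qed.

(** Here Landen's step starts from [q ^ 2]: the means of theta_a(q^2) and theta_c(q^2) are
    theta_a(q) / 2 and theta_c(q) / 2. Homogeneity turns the halves into the factor 2 that matches
    ln (q^2) = 2 ln q. *)
Lemma agm_int_ac_step (q : R) : 0 < q < 1 ->
  agm_int (theta_a q) (theta_c q) = agm_int (theta_a (q ^ 2)) (theta_c (q ^ 2)) / 2.
Proof.
  intros Hq. assert (Hq2 := pow2_in_unit q Hq).
  destruct (theta_ab_bounds q Hq) as (B & A & L).
  destruct (theta_ab_bounds _ Hq2) as (B2 & A2 & L2).
  assert (Hq0 : 0 <= q < 1) by lra.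
  destruct (theta_ab_step q Hq0) as [E1 E2].
  assert (E3 := theta_c_step q Hq). assert (C := theta_c_pos q Hq). assert (C2 := theta_c_pos _ Hq2).
  assert (E4 := theta_c_sqr q Hq).
  rewrite (agm_int_step (theta_a (q ^ 2)) (theta_c (q ^ 2))) by lra.
  replace (sqrt (theta_a (q ^ 2) * theta_c (q ^ 2))) with (/ 2 * theta_c q).
  replace ((theta_a (q ^ 2) + theta_c (q ^ 2)) / 2) with (/ 2 * theta_a q) by (rewrite E1, E3; field).
  rewrite agm_int_homog by lra. field.
  symmetry. rewrite E1, E3.
  replace (_ * _) with ((/ 2 * theta_c q) ^ 2) by (rewrite Rpow_mult_distr, E4; field).
  apply sqrt_pow2. lra.
Qed.

(** The interval up to [d] is stable under squaring, so [n] applications of the contraction bound |h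
    q| by C / 2^n. *)
Lemma square_contraction_0 (h : R -> R) (C d : R) : 0 < d < / 2 ->
  (forall q, 0 < q <= d -> Rabs (h q) <= C) ->
  (forall q, 0 < q <= d -> Rabs (h q) <= Rabs (h (q ^ 2)) / 2) ->
  forall q, 0 < q <= d -> h q = 0.
Proof.
  intros Hd HC H q Hq.
  assert (A : forall n q, 0 < q <= d -> Rabs (h q) <= C * (/ 2) ^ n).
  { induction n as [|n IH]; intros p Hp. simpl. rewrite Rmult_1_r. now apply HC.
    assert (H1 := H p Hp). assert (H2 : 0 < p ^ 2 <= d) by nra. assert (H3 := IH _ H2).
    rewrite <- tech_pow_Rmult. lra. }
  assert (L : is_lim_seq (fun n => C * (/ 2) ^ n) 0).
  { replace (Finite 0) with (Rbar_mult C 0) by (simpl; f_equal; ring).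
    apply is_lim_seq_scal_l. apply is_lim_seq_geom. rewrite Rabs_pos_eq; lra. }
  assert (B : Rbar_le (Rabs (h q)) 0).
  { refine (is_lim_seq_le _ _ _ _ _ (is_lim_seq_const _) L). intros n. now apply A. }
  simpl in B. assert (H0 := Rabs_pos (h q)).
  destruct (Req_dec (h q) 0) as [E|N]; auto. apply Rabs_pos_lt in N. lra.
Qed.

Lemma square_descent_pos (P : R -> Prop) (d : R) : 0 < d ->
  (forall q, 0 < q <= d -> P q) -> (forall q, 0 < q < 1 -> P (q ^ 2) -> P q) ->
  forall q, 0 < q < 1 -> P q.
Proof.
  intros Hd H0 H1 q Hq.
  enough (H : 0 < q -> P q) by (apply H; lra).
  apply (square_descent (fun q => 0 < q -> P q) d); auto.
  - intros p Hp Pp. apply H0. rewrite Rabs_pos_eq in Hp; lra.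
  - intros p Hp IH Pp. rewrite Rabs_pos_eq in Hp by lra. apply H1. lra. apply IH. now apply pow_lt.
  - rewrite Rabs_pos_eq; lra.
Qed.

(** The constant is 16/7 = 2 / (1 - 1/8), from 2 q / (1 - q) on this range. *)
Lemma theta_small_bounds (q : R) : 0 < q <= / 8 ->
  1 <= theta_lim (- q) <= 1 + 16 / 7 * q /\ 1 - 16 / 7 * q <= theta_lim q <= 1 /\
  4 * q <= theta_lim (- q) - theta_lim q.
Proof.
  intros Hq. assert (Hq0 : 0 <= q < 1) by lra.
  assert (P := theta_lim_pos q Hq0). assert (N := theta_lim_neg_ge_1 q Hq0).
  assert (D := theta_lim_diff_ge q Hq0).
  assert (H1 : Rabs q < 1) by (rewrite Rabs_pos_eq; lra).
  assert (H2 : Rabs (- q) < 1) by now rewrite Rabs_Ropp.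
  assert (B1 := theta_lim_near_1 _ H1). assert (B2 := theta_lim_near_1 _ H2).
  rewrite Rabs_Ropp in B2. rewrite (Rabs_pos_eq q) in B1, B2 by lra.
  assert (2 * q / (1 - q) <= 16 / 7 * q).
  { apply Rmult_le_reg_r with (1 - q). lra. unfold Rdiv. rewrite Rmult_assoc, Rinv_l by lra. nra. }
  apply Rabs_le_between in B1. apply Rabs_le_between in B2. repeat split; lra.
Qed.

Lemma theta_ab_small_bounds (q : R) : 0 < q <= / 8 ->
  1 <= theta_a q <= 1 + 6 * q /\ 1 - 5 * q <= theta_b q <= 1 /\ 4 * q <= theta_c q ^ 2 <= 80 * q.
Proof.
  intros Hq. destruct (theta_small_bounds q Hq) as (A & B & C).
  assert (Hq1 : 0 < q < 1) by lra. rewrite (theta_c_sqr q Hq1).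
  unfold theta_a, theta_b. set (u := theta_lim (- q)) in *. set (v := theta_lim q) in *.
  assert (U : 1 <= u ^ 2 <= 1 + 6 * q) by (split; nra).
  assert (V : 1 - 5 * q <= v ^ 2 <= 1) by (split; nra).
  assert (W : 4 * q <= u ^ 2 - v ^ 2 <= 20 * q).
  { replace (u ^ 2 - v ^ 2) with ((u - v) * (u + v)) by ring. split; nra. }
  replace ((u ^ 2) ^ 2 - (v ^ 2) ^ 2) with ((u ^ 2 - v ^ 2) * (u ^ 2 + v ^ 2)) by ring.
  repeat split; nra.
Qed.

Lemma agm_int_theta_ab (q : R) : 0 < q < 1 -> agm_int (theta_a q) (theta_b q) = PI / 2.
Proof.
  revert q. apply square_descent_pos with (/ 8). lra.
  2:{ intros q Hq H. rewrite agm_int_ab_step; auto. }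
  intros q Hq.
  (* The difference itself is invariant under q -> q^2, so nothing contracts. Its quotient by [q]
     stays bounded, as theta_a and theta_b are 1 + O(q), and gets multiplied by [q <= / 8] from q^2
     to q. *)
  enough (E : (agm_int (theta_a q) (theta_b q) - PI / 2) / q = 0).
  { apply Rmult_eq_compat_r with (r := q) in E. unfold Rdiv in E at 1.
    rewrite Rmult_assoc, Rinv_l in E by lra. lra. }
  revert q Hq. apply square_contraction_0 with 40. lra.
  - intros q Hq. destruct (theta_ab_small_bounds q Hq) as (A & B & C).
    assert (Hq1 : 0 < q < 1) by lra. destruct (theta_ab_bounds q Hq1) as (B' & A' & L).
    assert (Hba : 0 < theta_b q <= theta_a q) by lra.
    assert (J := agm_int_bounds _ _ Hba).
    assert (P4 := PI_4). assert (P0 := PI_RGT_0).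
    set (a := theta_a q) in *. set (b := theta_b q) in *. set (j := agm_int a b) in *.
    assert (J1 : PI / 2 - PI / 2 / a <= 12 * q).
    { replace (PI / 2 - PI / 2 / a) with (PI / 2 * ((a - 1) / a)) by (field; lra).
      assert ((a - 1) / a <= 6 * q).
      { apply Rmult_le_reg_r with a. lra. unfold Rdiv. rewrite Rmult_assoc, Rinv_l by lra. nra. }
      nra. }
    assert (J2 : PI / 2 / b - PI / 2 <= 40 * q).
    { replace (PI / 2 / b - PI / 2) with (PI / 2 * ((1 - b) / b)) by (field; lra).
      assert ((1 - b) / b <= 20 * q).
      { apply Rmult_le_reg_r with b. lra. unfold Rdiv. rewrite Rmult_assoc, Rinv_l by lra. nra. }
      nra. }
    unfold Rdiv at 1. rewrite Rabs_mult, (Rabs_pos_eq (/ q)) by (left; apply Rinv_0_lt_compat; lra).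
    apply Rmult_le_reg_r with q. lra. rewrite Rmult_assoc, Rinv_l by lra.
    rewrite Rmult_1_r. apply Rabs_le. lra.
  - intros q Hq. rewrite (agm_int_ab_step q) by lra.
    set (x := agm_int _ _ - PI / 2).
    assert (Hq2 : 0 < q ^ 2) by nra.
    assert (Hi := Rinv_0_lt_compat _ Hq2). assert (Hi1 : 0 < / q) by (apply Rinv_0_lt_compat; lra).
    unfold Rdiv. rewrite !Rabs_mult, (Rabs_pos_eq (/ q)), (Rabs_pos_eq (/ q ^ 2)) by lra.
    rewrite Rmult_assoc. apply Rmult_le_compat_l. apply Rabs_pos.
    apply Rmult_le_reg_r with (q ^ 2). auto. replace (/ q * q ^ 2) with q by (field; lra).
    replace (/ q ^ 2 * / 2 * q ^ 2) with (/ 2) by (field; lra). lra.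
Qed.

Lemma ln_le_sub_1 (x : R) : 0 < x -> ln x <= x - 1.
Proof.
  intros Hx. assert (H := exp_ineq1_le (ln x)). rewrite exp_ln in H by auto. lra.
Qed.

Lemma agm_int_theta_ac (q : R) : 0 < q < 1 -> agm_int (theta_a q) (theta_c q) = - ln q / 2.
Proof.
  revert q. apply square_descent_pos with (/ 8). lra.
  2:{ intros q Hq H. rewrite agm_int_ac_step, H by auto.
      replace (q ^ 2) with (q * q) by ring. rewrite ln_mult by lra. field. }
  intros q Hq. enough (E : agm_int (theta_a q) (theta_c q) + ln q / 2 = 0) by lra.
  revert q Hq.
  apply square_contraction_0 with 300. lra.
  - intros q Hq. destruct (theta_ab_small_bounds q Hq) as (A & B & C).
    assert (Hq1 : 0 < q < 1) by lra. destruct (theta_ab_bounds q Hq1) as (B' & A' & L).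
    assert (Cp := theta_c_pos q Hq1). assert (Cs := theta_c_sqr q Hq1).
    assert (J := agm_int_log_bounds (theta_a q) (theta_b q) (theta_c q)).
    assert (P4 := PI_4). assert (P0 := PI_RGT_0).
    set (a := theta_a q) in *. set (b := theta_b q) in *. set (c := theta_c q) in *.
    assert (Ha : 0 < a) by lra. assert (Hb : 0 < b) by lra.
    assert (E : a ^ 2 = b ^ 2 + c ^ 2) by lra. specialize (J Ha Hb Cp E).
    set (X := ln ((a + b) / c)) in *.
    assert (X2 : 2 * X = 2 * ln (a + b) - ln (c ^ 2)).
    { unfold X. rewrite ln_div by lra. replace (c ^ 2) with (c * c) by ring. rewrite ln_mult by lra. ring. }
    assert (Lab : 0 <= ln (a + b) <= 3).
    { split. rewrite <- ln_1. apply ln_le; lra. assert (H := ln_le_sub_1 (a + b)). lra. }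
    assert (Lc : ln q <= ln (c ^ 2) <= 79 + ln q).
    { split. apply ln_le; lra. apply Rle_trans with (ln (80 * q)). apply ln_le; lra.
      rewrite ln_mult by lra. assert (H := ln_le_sub_1 80). lra. }
    assert (Lq : 0 <= - ln q <= / q - 1).
    { rewrite <- ln_Rinv by lra. split.
      rewrite <- ln_1. apply ln_le. lra. rewrite <- Rinv_1. apply Rinv_le_contravar; lra.
      apply ln_le_sub_1. apply Rinv_0_lt_compat; lra. }
    (* [X] is unbounded as q tends to 0, but even the crude estimate 1 / q + 45 suffices: replacing
       [X / b] by [X] costs [X] times (1 - b) / b <= 20 q. *)
    assert (Xb : Rabs (X / b - X) <= 20 * 3 + 80 * 2).
    { replace (X / b - X) with (X * ((1 - b) / b)) by (field; lra).
      assert (H : 0 <= (1 - b) / b <= 20 * q).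
      { split. apply Rdiv_le_0_compat; lra.
        apply Rmult_le_reg_r with b. lra. unfold Rdiv. rewrite Rmult_assoc, Rinv_l by lra. nra. }
      rewrite Rabs_mult, (Rabs_pos_eq ((1 - b) / b)) by lra.
      assert (HX : Rabs X <= / q + 45) by (apply Rabs_le; lra).
      apply Rle_trans with ((/ q + 45) * (20 * q)).
      apply Rmult_le_compat; try lra. apply Rabs_pos.
      replace ((/ q + 45) * (20 * q)) with (20 + 900 * q) by (field; lra). lra. }
    assert (Pa : 0 <= PI / 2 / a <= 2).
    { split. apply Rdiv_le_0_compat; lra. apply Rmult_le_reg_r with a. lra.
      unfold Rdiv. rewrite Rmult_assoc, Rinv_l by lra. lra. }
    apply Rabs_le_between in Xb. apply Rabs_le. lra.
  (* Both the integral and the logarithm halve from q^2 to q, so the contraction is an equality. *)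
  - intros q Hq. rewrite (agm_int_ac_step q) by lra.
    replace (q ^ 2) with (q * q) by ring. rewrite ln_mult by lra.
    match goal with |- Rabs ?x <= Rabs ?y / 2 => replace x with (y / 2) by field end.
    unfold Rdiv at 1. rewrite Rabs_mult, (Rabs_pos_eq (/ 2)) by lra. lra.
Qed.

(* Complete elliptic integrals as functions of the parameter m = k^2. *)
Definition modular (m p : R) : R := 1 - m * sin p ^ 2.
Definition ellK (m : R) : R := RInt (fun p => / sqrt (modular m p)) 0 (PI / 2).
Definition ellE (m : R) : R := RInt (fun p => sqrt (modular m p)) 0 (PI / 2).

Lemma sin2_bounds (p : R) : 0 <= sin p ^ 2 <= 1.
Proof.
  assert (H := sin2_add_cos2 p). assert (H1 := pow2_ge_0 (sin p)). assert (H2 := pow2_ge_0 (cos p)). lra.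
Qed.

Lemma modular_pos (m p : R) : m < 1 -> 0 < modular m p.
Proof.
  intros Hm. assert (H := sin2_bounds p). unfold modular.
  destruct (Rle_lt_dec m 0); nra.
Qed.

Lemma modular_bounds (m p : R) : 0 <= m -> 1 - m <= modular m p <= 1.
Proof. intros Hm. assert (H := sin2_bounds p). unfold modular. split; nra. Qed.

Lemma quad_modular (m p : R) : m < 1 -> quad 1 (sqrt (1 - m)) p = modular m p.
Proof.
  intros Hm. unfold quad, modular. rewrite pow2_sqrt by lra.
  assert (H := sin2_add_cos2 p). replace (cos p ^ 2) with (1 - sin p ^ 2) by lra. ring.
Qed.

Lemma ellK_agm (m : R) : m < 1 -> ellK m = agm_int 1 (sqrt (1 - m)).
Proof.
  intros Hm. unfold ellK, agm_int. apply RInt_ext. intros p _. now rewrite quad_modular.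
Qed.

Lemma continuous_inv_sqrt_modular (m p : R) : m < 1 -> continuous (fun p => / sqrt (modular m p)) p.
Proof.
  intros Hm. assert (W := modular_pos m p Hm). assert (S := sqrt_lt_R0 _ W).
  apply (ex_derive_continuous (fun p => / sqrt (modular m p))). unfold modular in *.
  auto_derive. repeat split; auto. now apply Rgt_not_eq.
Qed.

Lemma continuous_sqrt_modular (m p : R) : m < 1 -> continuous (fun p => sqrt (modular m p)) p.
Proof.
  intros Hm. assert (W := modular_pos m p Hm).
  apply (ex_derive_continuous (fun p => sqrt (modular m p))). unfold modular in *.
  auto_derive. repeat split; auto.
Qed.

Lemma ex_RInt_inv_sqrt_modular (m u v : R) : m < 1 -> ex_RInt (fun p => / sqrt (modular m p)) u v.
Proof.
  intros. apply (ex_RInt_continuous (V := R_CompleteNormedModule)). intros.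
  now apply continuous_inv_sqrt_modular.
Qed.

Lemma ex_RInt_sqrt_modular (m u v : R) : m < 1 -> ex_RInt (fun p => sqrt (modular m p)) u v.
Proof.
  intros. apply (ex_RInt_continuous (V := R_CompleteNormedModule)). intros.
  now apply continuous_sqrt_modular.
Qed.

Lemma ellK_incr (m1 m2 : R) : m1 < m2 < 1 -> ellK m1 < ellK m2.
Proof.
  intros H. assert (HP := PI_RGT_0). apply RInt_lt. lra.
  intros. apply continuous_inv_sqrt_modular; lra.
  intros. apply continuous_inv_sqrt_modular; lra.
  intros p Hp. assert (W1 : 0 < modular m1 p) by (apply modular_pos; lra).
  assert (W2 : 0 < modular m2 p) by (apply modular_pos; lra).
  apply Rinv_lt_contravar. apply Rmult_lt_0_compat; now apply sqrt_lt_R0.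
  apply sqrt_lt_1_alt. split. lra. unfold modular.
  assert (0 < sin p) by (apply sin_gt_0; lra). assert (0 < sin p ^ 2) by now apply pow_lt. nra.
Qed.

Lemma ellK_bounds (m : R) : 0 <= m < 1 -> PI / 2 <= ellK m <= PI / 2 / sqrt (1 - m).
Proof.
  intros Hm. rewrite ellK_agm by lra.
  assert (B : 0 < sqrt (1 - m) <= 1).
  { split. apply sqrt_lt_R0; lra. rewrite <- sqrt_1 at 2. apply sqrt_le_1_alt; lra. }
  assert (H := agm_int_bounds 1 _ B). lra.
Qed.

Lemma ellK_pos (m : R) : 0 <= m < 1 -> 0 < ellK m.
Proof. intros Hm. assert (H := ellK_bounds m Hm). assert (HP := PI_RGT_0). lra. Qed.

(** With k' = theta_b / theta_a and k = theta_c / theta_a, homogeneity extracts theta_a from both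
    integrals. In particular PI K' / K = - ln q. *)
Lemma ellK_at_nome (q : R) : 0 < q < 1 ->
  let m := 1 - (theta_b q / theta_a q) ^ 2 in
  0 < m < 1 /\ ellK m = theta_a q * (PI / 2) /\ ellK (1 - m) = theta_a q * (- ln q / 2).
Proof.
  intros Hq m. destruct (theta_ab_bounds q Hq) as (B & A & L).
  assert (C := theta_c_pos q Hq). assert (Cs := theta_c_sqr q Hq).
  assert (R1 : 0 < theta_b q / theta_a q < 1).
  { split. apply Rdiv_lt_0_compat; lra. apply Rmult_lt_reg_r with (theta_a q). lra.
    unfold Rdiv. rewrite Rmult_assoc, Rinv_l by lra. lra. }
  assert (Hm : 0 < m < 1) by (unfold m; split; nra).
  assert (Ia : 0 < / theta_a q) by (apply Rinv_0_lt_compat; lra).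
  split; auto. split.
  - rewrite ellK_agm by lra. replace (1 - m) with ((theta_b q / theta_a q) ^ 2) by (unfold m; ring).
    rewrite sqrt_pow2 by lra. rewrite <- (agm_int_theta_ab q Hq).
    replace 1 with (/ theta_a q * theta_a q) by (apply Rinv_l; lra).
    unfold Rdiv at 1. rewrite (Rmult_comm (theta_b q)). rewrite agm_int_homog by lra. field. lra.
  - rewrite ellK_agm by lra. replace (1 - (1 - m)) with ((theta_c q / theta_a q) ^ 2).
    2:{ unfold Rdiv at 1. rewrite Rpow_mult_distr, Cs. unfold m. field. lra. }
    rewrite sqrt_pow2 by (apply Rdiv_le_0_compat; lra). rewrite <- (agm_int_theta_ac q Hq).
    replace 1 with (/ theta_a q * theta_a q) by (apply Rinv_l; lra).
    unfold Rdiv at 1. rewrite (Rmult_comm (theta_c q)). rewrite agm_int_homog by lra. field. lra.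
Qed.

Definition ell_ratio (m : R) : R := PI * ellK (1 - m) / ellK m.

Lemma ell_ratio_decr (m1 m2 : R) : 0 < m1 -> m1 < m2 -> m2 < 1 -> ell_ratio m2 < ell_ratio m1.
Proof.
  intros H0 H H1. assert (HP := PI_RGT_0). unfold ell_ratio.
  assert (K1 : 0 < ellK m1) by (apply ellK_pos; lra).
  assert (K2 : ellK m1 < ellK m2) by (apply ellK_incr; lra).
  assert (K3 : 0 < ellK (1 - m2)) by (apply ellK_pos; lra).
  assert (K4 : ellK (1 - m2) < ellK (1 - m1)) by (apply ellK_incr; lra).
  apply Rlt_trans with (PI * ellK (1 - m2) / ellK m1).
  - apply Rmult_lt_compat_l. now apply Rmult_lt_0_compat. apply Rinv_lt_contravar; auto.
    apply Rmult_lt_0_compat; lra.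
  - apply Rmult_lt_compat_r. now apply Rinv_0_lt_compat. now apply Rmult_lt_compat_l.
Qed.

Lemma ell_ratio_inj (m1 m2 : R) : 0 < m1 < 1 -> 0 < m2 < 1 -> ell_ratio m1 = ell_ratio m2 -> m1 = m2.
Proof.
  intros H1 H2 E. destruct (Rtotal_order m1 m2) as [L|[L|L]]; auto.
  - assert (X := ell_ratio_decr m1 m2). lra.
  - assert (X := ell_ratio_decr m2 m1). lra.
Qed.

Lemma ell_ratio_pos (m : R) : 0 < m < 1 -> 0 < ell_ratio m.
Proof.
  intros Hm. apply Rdiv_lt_0_compat. apply Rmult_lt_0_compat. apply PI_RGT_0.
  apply ellK_pos; lra. apply ellK_pos; lra.
Qed.

(** Every modulus comes from a nome: the parameter attached to exp (- ell_ratio m) has the same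
    [ell_ratio] as [m], and strict monotonicity makes the two equal. *)
Lemma theta_lim_sqr_ellK (m : R) : 0 < m < 1 ->
  theta_lim (exp (- ell_ratio m)) ^ 2 = 2 * sqrt (1 - m) * ellK m / PI.
Proof.
  intros Hm. assert (HP := PI_RGT_0). assert (Rp := ell_ratio_pos m Hm).
  set (q := exp (- ell_ratio m)).
  assert (Hq : 0 < q < 1).
  { split. apply exp_pos. unfold q. rewrite <- exp_0. apply exp_increasing. lra. }
  destruct (theta_ab_bounds q Hq) as (B & A & L).
  destruct (ellK_at_nome q Hq) as (Hm' & K1 & K2).
  set (m' := 1 - (theta_b q / theta_a q) ^ 2) in *.
  assert (E : m' = m).
  { apply ell_ratio_inj; auto. unfold ell_ratio at 1. rewrite K1, K2.
    unfold q. rewrite ln_exp. field. fold q. lra. }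
  rewrite <- E, K1. replace (1 - m') with ((theta_b q / theta_a q) ^ 2) by (unfold m'; ring).
  rewrite sqrt_pow2 by (apply Rdiv_le_0_compat; lra).
  change (theta_lim q ^ 2) with (theta_b q). field. lra.
Qed.

(** * Derivatives of K and E, and Legendre's relation *)

Lemma locally_lt_1 (m : R) : m < 1 -> locally m (fun y => y < 1).
Proof. intros Hm. apply (open_lt 1). exact Hm. Qed.

(** Differentiation under the integral sign, once for both integrals: [g] is the square root for
    [ellE] and its inverse for [ellK]. Regularity on positive arguments suffices because
    [modular m p] is positive for m < 1. *)
Lemma is_derive_RInt_modular (g h : R -> R) (m : R) : m < 1 ->
  (forall w, 0 < w -> is_derive g w (h w)) -> (forall w, 0 < w -> continuous h w) ->
  is_derive (fun m => RInt (fun p => g (modular m p)) 0 (PI / 2)) m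
    (RInt (fun p => - sin p ^ 2 * h (modular m p)) 0 (PI / 2)).
Proof.
  intros Hm Hg Hh.
  assert (D : forall u v, u < 1 -> is_derive (fun z => g (modular z v)) u (- sin v ^ 2 * h (modular u v))).
  { intros u v Hu. assert (W := modular_pos u v Hu).
    apply (is_derive_comp g (fun z => modular z v)). auto.
    unfold modular. auto_derive; auto. ring. }
  rewrite <- (RInt_ext (fun t => Derive (fun u => g (modular u t)) m)).
  2:{ intros p _. apply is_derive_unique. now apply D. }
  apply (is_derive_RInt_param (fun m p => g (modular m p))).
  - apply filter_imp with (2 := locally_lt_1 m Hm). intros y Hy t _. eexists. now apply D.
  - intros t _. apply continuity_2d_pt_ext_loc with (fun u v => - sin v ^ 2 * h (modular u v)).
    + destruct (locally_lt_1 m Hm) as [d Hd]. exists d. intros u v Hu _.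
      symmetry. apply is_derive_unique, D, Hd, Hu.
    + apply continuity_2d_pt_filterlim.
      assert (Cs : forall k, ex_derive (fun w => k * sin w ^ 2) t) by (intros; auto_derive; auto).
      assert (C1 : forall k, continuous (fun z : R * R => k * sin (snd z) ^ 2) (m, t)).
      { intros k. apply (continuous_comp (fun z : R * R => snd z) (fun w => k * sin w ^ 2)).
        apply continuous_snd. apply (ex_derive_continuous (fun w => k * sin w ^ 2)), Cs. }
      assert (C2 : continuous (fun z : R * R => fst z * (-1 * sin (snd z) ^ 2)) (m, t)).
      { exact (continuous_mult (K := R_AbsRing) _ _ _ (continuous_fst m t) (C1 (-1))). }
      assert (C3 : continuous (fun z : R * R => h (1 + fst z * (-1 * sin (snd z) ^ 2))) (m, t)).
      { apply (continuous_comp (fun z : R * R => fst z * (-1 * sin (snd z) ^ 2)) (fun w => h (1 + w))).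
        exact C2. apply (continuous_comp (fun w => 1 + w) h).
        apply (ex_derive_continuous (fun w => 1 + w)). auto_derive. auto.
        apply Hh. assert (W := modular_pos m t Hm). unfold modular in W. simpl fst; simpl snd. lra. }
      assert (C4 := continuous_mult (K := R_AbsRing) _ _ _ (C1 (-1)) C3).
      refine (continuous_ext _ _ _ _ C4).
      intros z. change (-1 * sin (snd z) ^ 2 * h (1 + fst z * (-1 * sin (snd z) ^ 2)) =
        - sin (snd z) ^ 2 * h (modular (fst z) (snd z))).
      unfold modular. f_equal. ring. f_equal. ring.
  - apply filter_imp with (2 := locally_lt_1 m Hm). intros y Hy.
    apply (ex_RInt_continuous (V := R_CompleteNormedModule)). intros z _.
    assert (W := modular_pos y z Hy).
    apply (continuous_comp (fun p => modular y p) g).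
    apply (ex_derive_continuous (fun p => modular y p)). unfold modular. auto_derive. auto.
    apply (ex_derive_continuous g). eexists. now apply Hg.
Qed.

Lemma RInt_lin2 (f g : R -> R) (a b x y : R) : ex_RInt f x y -> ex_RInt g x y ->
  RInt (fun p => a * f p + b * g p) x y = a * RInt f x y + b * RInt g x y.
Proof.
  intros Hf Hg. rewrite <- !RInt_Rmult_l by auto.
  apply (RInt_plus (V := R_CompleteNormedModule) (fun p => a * f p) (fun p => b * g p)).
  now apply (ex_RInt_scal (V := R_NormedModule) f). now apply (ex_RInt_scal (V := R_NormedModule) g).
Qed.

Lemma is_derive_ellE (m : R) : 0 < m < 1 -> is_derive ellE m ((ellE m - ellK m) / (2 * m)).
Proof.
  intros Hm.
  replace ((ellE m - ellK m) / (2 * m)) with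
    (RInt (fun p => - sin p ^ 2 * / (2 * sqrt (modular m p))) 0 (PI / 2)).
  - apply (is_derive_RInt_modular sqrt (fun w => / (2 * sqrt w))). lra.
    + intros w Hw. auto_derive; auto. field. now apply Rgt_not_eq, sqrt_lt_R0.
    + intros w Hw. apply (ex_derive_continuous (fun w => / (2 * sqrt w))).
      assert (S := sqrt_lt_R0 _ Hw). auto_derive. split; auto. lra.
  - replace ((ellE m - ellK m) / (2 * m)) with (/ (2 * m) * ellE m + - / (2 * m) * ellK m) by (field; lra).
    unfold ellE, ellK. rewrite <- RInt_lin2.
    2: apply ex_RInt_sqrt_modular; lra. 2: apply ex_RInt_inv_sqrt_modular; lra.
    apply RInt_ext. intros p _. assert (W : 0 < modular m p) by (apply modular_pos; lra).
    assert (S := sqrt_lt_R0 _ W). assert (S2 := sqrt_sqrt _ (Rlt_le _ _ W)).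
    (* Eliminating sin^2 through r^2 = 1 - m sin^2 makes the integrand a combination of r and 1 /
       r. *)
    assert (X : sin p ^ 2 = (1 - sqrt (modular m p) * sqrt (modular m p)) / m)
      by (rewrite S2; unfold modular; field; lra).
    rewrite X. set (r := sqrt (modular m p)) in *.
    match goal with |- ?x = ?y => change (@eq R x y) end. field. lra.
Qed.

(** The primitive [G] = m sin cos / sqrt (modular) vanishes at both ends, and its derivative is sqrt
    (modular) minus (1 - m) times the integrand here. This evaluates the new integral occurring in
    the derivative of [ellK]. *)
Lemma RInt_modular_m32 (m : R) : 0 < m < 1 ->
  (1 - m) * RInt (fun p => / (sqrt (modular m p) * modular m p)) 0 (PI / 2) = ellE m.
Proof.
  intros Hm. assert (Wp : forall p, 0 < modular m p) by (intros; apply modular_pos; lra).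
  set (G := fun p => m * (sin p * cos p) / sqrt (modular m p)).
  set (f := fun p => / (sqrt (modular m p) * modular m p)).
  assert (Cf : forall p, continuous f p).
  { intros p. apply (ex_derive_continuous f). unfold f. assert (W := Wp p). assert (S := sqrt_lt_R0 _ W).
    assert (0 < sqrt (modular m p) * modular m p) by now apply Rmult_lt_0_compat.
    unfold modular in *. auto_derive. split; auto. split; auto. now apply Rgt_not_eq. }
  assert (If : ex_RInt f 0 (PI / 2)) by (apply (ex_RInt_continuous (V := R_CompleteNormedModule)); auto).
  assert (Is : ex_RInt (fun p => sqrt (modular m p)) 0 (PI / 2)) by (apply ex_RInt_sqrt_modular; lra).
  assert (D : forall p, is_derive G p (1 * sqrt (modular m p) + - (1 - m) * f p)).
  { intros p. assert (W := Wp p). assert (S := sqrt_lt_R0 _ W). unfold G, f.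
    assert (S2 := sqrt_sqrt _ (Rlt_le _ _ W)).
    unfold modular in *. auto_derive. repeat split; auto. now apply Rgt_not_eq.
    assert (C2 := sin2_add_cos2 p).
    simpl in *. set (r := sqrt (1 - m * (sin p * (sin p * 1)))) in *.
    assert (Sq : sin p * (sin p * 1) = (1 - r * r) / m) by (rewrite S2; field; lra).
    assert (Cq : cos p * cos p = 1 - (1 - r * r) / m) by (rewrite <- Sq; lra).
    rewrite <- S2.
    change (1 + - (m * (sin p * (sin p * 1)))) with (1 - m * (sin p * (sin p * 1))). fold r.
    match goal with |- ?L = _ => replace L with
      (m * (cos p * cos p - sin p * (sin p * 1)) / r + m ^ 2 * (sin p * (sin p * 1)) * (cos p * cos p) / (r * r * r))
      by (field; lra) end.
    rewrite Sq, Cq. field. lra. }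
  assert (I : is_RInt (fun p => 1 * sqrt (modular m p) + - (1 - m) * f p) 0 (PI / 2) (G (PI / 2) - G 0)).
  { apply (is_RInt_derive G). intros; apply D.
    intros p _. apply (continuous_plus (V := R_NormedModule) (fun p => 1 * sqrt (modular m p)) (fun p => - (1 - m) * f p)).
    apply (continuous_mult (K := R_AbsRing)). apply continuous_const. apply continuous_sqrt_modular; lra.
    apply (continuous_mult (K := R_AbsRing)). apply continuous_const. apply Cf. }
  apply (is_RInt_unique (V := R_CompleteNormedModule)) in I. rewrite RInt_lin2 in I by auto.
  replace (G (PI / 2) - G 0) with 0 in I.
  fold (ellE m) in I. fold f. lra.
  unfold G. rewrite cos_PI2, sin_0. unfold Rdiv. ring.
Qed.

Lemma is_derive_ellK (m : R) : 0 < m < 1 -> is_derive ellK m ((ellE m / (1 - m) - ellK m) / (2 * m)).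
Proof.
  intros Hm.
  replace ((ellE m / (1 - m) - ellK m) / (2 * m)) with
    (RInt (fun p => - sin p ^ 2 * (- / (2 * (sqrt (modular m p) * modular m p)))) 0 (PI / 2)).
  - apply (is_derive_RInt_modular (fun w => / sqrt w) (fun w => - / (2 * (sqrt w * w)))). lra.
    + intros w Hw. assert (S := sqrt_lt_R0 _ Hw). assert (S2 := sqrt_sqrt _ (Rlt_le _ _ Hw)).
      auto_derive. repeat split; auto. lra. rewrite S2. field. lra.
    + intros w Hw. apply (ex_derive_continuous (fun w => - / (2 * (sqrt w * w)))).
      assert (S := sqrt_lt_R0 _ Hw). assert (0 < sqrt w * w) by now apply Rmult_lt_0_compat.
      auto_derive. repeat split; auto. lra.
  - rewrite <- (RInt_modular_m32 m Hm).
    set (f := fun p => / (sqrt (modular m p) * modular m p)).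
    replace (((1 - m) * RInt f 0 (PI / 2) / (1 - m) - ellK m) / (2 * m)) with
      (/ (2 * m) * RInt f 0 (PI / 2) + - / (2 * m) * ellK m) by (field; lra).
    unfold ellK. rewrite <- RInt_lin2.
    + apply RInt_ext. intros p _. assert (W : 0 < modular m p) by (apply modular_pos; lra).
      assert (S := sqrt_lt_R0 _ W).
      assert (X : sin p ^ 2 = (1 - modular m p) / m) by (unfold modular; field; lra).
      rewrite X. unfold f. set (w := modular m p) in *. set (r := sqrt w) in *.
      match goal with |- ?x = ?y => change (@eq R x y) end. field. lra.
    + apply (ex_RInt_continuous (V := R_CompleteNormedModule)). intros p _. apply (ex_derive_continuous f).
      unfold f. assert (W : 0 < modular m p) by (apply modular_pos; lra). assert (S := sqrt_lt_R0 _ W).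
      assert (0 < sqrt (modular m p) * modular m p) by now apply Rmult_lt_0_compat.
      unfold modular in *. auto_derive. split; auto. split; auto. now apply Rgt_not_eq.
    + apply ex_RInt_inv_sqrt_modular; lra.
Qed.

(** Legendre's E'K + EK' - KK', grouped so that the factor K - E = O(m) absorbs the growth of K' as
    m tends to 0. *)
Definition legendre (m : R) : R := ellE (1 - m) * ellK m - (ellK m - ellE m) * ellK (1 - m).

Lemma is_derive_reflect (f : R -> R) (m l : R) : is_derive f (1 - m) l ->
  is_derive (fun m => f (1 - m)) m (- l).
Proof.
  intros H. replace (- l) with (scal (-1) l) by (change (-1 * l = - l); ring).
  apply (is_derive_comp f (fun m => 1 - m)). exact H. auto_derive; auto.
Qed.

Lemma is_derive_legendre (m : R) : 0 < m < 1 -> is_derive legendre m 0.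
Proof.
  intros Hm. assert (DK := is_derive_ellK m Hm). assert (DE := is_derive_ellE m Hm).
  assert (Hm' : 0 < 1 - m < 1) by lra.
  assert (DK' := is_derive_reflect _ _ _ (is_derive_ellK _ Hm')).
  assert (DE' := is_derive_reflect _ _ _ (is_derive_ellE _ Hm')).
  assert (A := is_derive_mult _ _ _ _ _ DE' DK Rmult_comm).
  assert (B := is_derive_mult _ _ _ _ _ (is_derive_minus _ _ _ _ _ DK DE) DK' Rmult_comm).
  assert (C := is_derive_minus _ _ _ _ _ A B).
  match type of C with is_derive _ _ ?v => replace 0 with v; [exact C|] end.
  unfold minus, plus, opp, mult; simpl. replace (1 - (1 - m)) with m by ring. field. lra.
Qed.

(** The radicand is cos^2 + m sin^2, hence between cos^2 and (cos + sqrt m)^2 on the range of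
    integration. *)
Lemma ellE_complement_bounds (m : R) : 0 < m < 1 -> 1 <= ellE (1 - m) <= 1 + 2 * sqrt m.
Proof.
  intros Hm. assert (HP := PI_RGT_0). assert (P4 := PI_4).
  assert (Ic : is_RInt cos 0 (PI / 2) (sin (PI / 2) - sin 0)).
  { apply (is_RInt_derive sin). intros; apply is_derive_Reals, derivable_pt_lim_sin.
    intros. apply (ex_derive_continuous cos). auto_derive. auto. }
  rewrite sin_PI2, sin_0, Rminus_0_r in Ic.
  assert (Ec : ex_RInt cos 0 (PI / 2)) by (eexists; exact Ic).
  apply (is_RInt_unique (V := R_CompleteNormedModule)) in Ic.
  assert (Ik : RInt (fun _ => 1) 0 (PI / 2) = PI / 2).
  { rewrite RInt_const. change ((PI / 2 - 0) * 1 = PI / 2). ring. }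
  assert (Ek : ex_RInt (fun _ => 1) 0 (PI / 2)) by apply ex_RInt_const.
  assert (Ie : ex_RInt (fun p => sqrt (modular (1 - m) p)) 0 (PI / 2)) by (apply ex_RInt_sqrt_modular; lra).
  assert (W : forall p, modular (1 - m) p = cos p ^ 2 + m * sin p ^ 2).
  { intros p. assert (H := sin2_add_cos2 p). unfold modular. lra. }
  assert (Sm : 0 < sqrt m) by (apply sqrt_lt_R0; lra).
  assert (Sm2 : sqrt m ^ 2 = m) by (apply pow2_sqrt; lra).
  split.
  - rewrite <- Ic at 1. unfold ellE. apply RInt_le; auto; try lra. intros p Hp.
    assert (0 < cos p) by (apply cos_gt_0; lra).
    rewrite <- (sqrt_pow2 (cos p)) by lra. apply sqrt_le_1_alt. rewrite W.
    assert (H1 := pow2_ge_0 (sin p)). nra.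
  - apply Rle_trans with (1 * RInt cos 0 (PI / 2) + sqrt m * RInt (fun _ => 1) 0 (PI / 2)).
    2:{ rewrite Ic, Ik. nra. }
    rewrite <- RInt_lin2 by auto. unfold ellE. apply RInt_le; auto; try lra.
    apply (ex_RInt_continuous (V := R_CompleteNormedModule)). intros p _.
    apply (ex_derive_continuous (fun p => 1 * cos p + sqrt m * 1)). auto_derive. auto.
    intros p Hp. assert (0 < cos p) by (apply cos_gt_0; lra).
    rewrite <- (sqrt_pow2 (1 * cos p + sqrt m * 1)) by lra. apply sqrt_le_1_alt. rewrite W.
    assert (H1 := sin2_bounds p). nra.
Qed.

Lemma ellK_minus_ellE_bounds (m : R) : 0 < m <= / 2 -> 0 <= ellK m - ellE m <= 4 * m.
Proof.
  intros Hm. assert (HP := PI_RGT_0). assert (P4 := PI_4).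
  assert (Ie : ex_RInt (fun p => sqrt (modular m p)) 0 (PI / 2)) by (apply ex_RInt_sqrt_modular; lra).
  assert (Ik : ex_RInt (fun p => / sqrt (modular m p)) 0 (PI / 2)) by (apply ex_RInt_inv_sqrt_modular; lra).
  assert (H : forall p, / sqrt (modular m p) - sqrt (modular m p) >= 0 /\
     / sqrt (modular m p) <= 1 * sqrt (modular m p) + 2 * m * 1).
  { intros p. assert (W : 0 < modular m p) by (apply modular_pos; lra).
    assert (B := modular_bounds m p). assert (S := sqrt_lt_R0 _ W).
    assert (S2 := sqrt_sqrt _ (Rlt_le _ _ W)).
    set (w := modular m p) in *. set (r := sqrt w) in *.
    assert (r <= 1) by nra. assert (/ 2 <= r) by nra.
    split.
    - apply Rge_minus, Rle_ge. apply Rmult_le_reg_r with r; auto. rewrite Rinv_l by lra. lra.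
    - apply Rmult_le_reg_r with r; auto. rewrite Rinv_l by lra. nra. }
  split.
  - enough (ellE m <= ellK m) by lra. apply RInt_le; auto; try lra. intros p _. destruct (H p). lra.
  - assert (C : RInt (fun _ => 1) 0 (PI / 2) = PI / 2).
    { rewrite RInt_const. change ((PI / 2 - 0) * 1 = PI / 2). ring. }
    assert (L : ellK m <= 1 * ellE m + 2 * m * RInt (fun _ => 1) 0 (PI / 2)).
    { unfold ellE. rewrite <- RInt_lin2 by (auto; apply ex_RInt_const). apply RInt_le; auto; try lra.
      - apply (ex_RInt_plus (V := R_NormedModule) (fun p => 1 * sqrt (modular m p)) (fun _ => 2 * m * 1)).
        now apply (ex_RInt_scal (V := R_NormedModule) (fun p => sqrt (modular m p))). apply ex_RInt_const.
      - intros p _. destruct (H p). lra. }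
    rewrite C in L. nra.
Qed.

Lemma legendre_near (m : R) : 0 < m <= / 2 -> Rabs (legendre m - PI / 2) <= 24 * sqrt m.
Proof.
  intros Hm. assert (HP := PI_RGT_0). assert (P4 := PI_4).
  assert (E' : 1 <= ellE (1 - m) <= 1 + 2 * sqrt m) by (apply ellE_complement_bounds; lra).
  assert (KE := ellK_minus_ellE_bounds m Hm).
  assert (K1 : PI / 2 <= ellK m <= PI / 2 / sqrt (1 - m)) by (apply ellK_bounds; lra).
  assert (K2 : PI / 2 <= ellK (1 - m) <= PI / 2 / sqrt (1 - (1 - m))) by (apply ellK_bounds; lra).
  replace (1 - (1 - m)) with m in K2 by ring.
  assert (Sm : 0 < sqrt m) by (apply sqrt_lt_R0; lra).
  assert (Sm2 : sqrt m * sqrt m = m) by (apply sqrt_sqrt; lra).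
  assert (Tm : 0 < sqrt (1 - m)) by (apply sqrt_lt_R0; lra).
  assert (Tm2 : sqrt (1 - m) * sqrt (1 - m) = 1 - m) by (apply sqrt_sqrt; lra).
  unfold legendre. set (r := sqrt m) in *. set (s := sqrt (1 - m)) in *.
  assert (r <= 3 / 4) by nra. assert (s <= 1) by nra.
  assert (U : PI / 2 / s <= PI / 2 * (1 + 2 * r)).
  { apply Rmult_le_compat_l. lra. apply Rmult_le_reg_r with s; auto. rewrite Rinv_l by lra.
    assert (1 - m <= s) by nra. nra. }
  assert (X : 0 <= (ellK m - ellE m) * ellK (1 - m) <= 8 * r).
  { split. apply Rmult_le_pos; lra.
    (* K - E <= 4 m beats K' <= (PI / 2) / sqrt m <= 2 / sqrt m and leaves 8 sqrt m. *)
    apply Rle_trans with (4 * (r * r) * (2 / r)).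
    - apply Rmult_le_compat; try lra. eapply Rle_trans. apply K2. unfold Rdiv at 1.
      apply Rmult_le_compat_r. left; now apply Rinv_0_lt_compat. lra.
    - right. field. lra. }
  assert (Y : PI / 2 <= ellE (1 - m) * ellK m <= PI / 2 + 16 * r).
  { split. nra. apply Rle_trans with ((1 + 2 * r) * (PI / 2 * (1 + 2 * r))).
    apply Rmult_le_compat; lra. nra. }
  apply Rabs_le. lra.
Qed.

Lemma legendre_relation (m : R) : 0 < m < 1 -> legendre m = PI / 2.
Proof.
  intros Hm.
  assert (C : forall x y, 0 < x -> x < y -> y < 1 -> legendre x = legendre y).
  { intros x y Hx Hxy Hy. apply (eq_is_derive legendre). intros t Ht. apply is_derive_legendre. lra. auto. }
  destruct (Req_dec (legendre m) (PI / 2)) as [E|N]; auto. exfalso.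
  assert (P : 0 < Rabs (legendre m - PI / 2)) by (apply Rabs_pos_lt; lra).
  set (e := Rabs (legendre m - PI / 2)) in *.
  (* At the parameter [r ^ 2] the estimate reads 24 r <= e / 2, contradicting the constant distance
     [e]; the other two bounds keep [r ^ 2] below [m] and below 1/2. *)
  set (r := Rmin (e / 48) (Rmin (m / 2) (/ 2))).
  assert (Hr : 0 < r /\ r <= e / 48 /\ r <= m / 2 /\ r <= / 2).
  { assert (A1 := Rmin_l (e / 48) (Rmin (m / 2) (/ 2))). assert (A2 := Rmin_r (e / 48) (Rmin (m / 2) (/ 2))).
    assert (A3 := Rmin_l (m / 2) (/ 2)). assert (A4 := Rmin_r (m / 2) (/ 2)). fold r in A1, A2.
    repeat split; try lra. unfold r. repeat apply Rmin_glb_lt; lra. }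
  assert (H : Rabs (legendre (r ^ 2) - PI / 2) <= 24 * sqrt (r ^ 2)) by (apply legendre_near; nra).
  rewrite sqrt_pow2 in H by lra. rewrite (C (r ^ 2) m) in H by nra. fold e in H. lra.
Qed.

(** * Tools for series *)

Lemma is_series_Un_cv (a : nat -> R) (l : R) : is_series a l <-> Un_cv (sum_f_R0 a) l.
Proof. rewrite is_series_Reals. reflexivity. Qed.

Lemma continuity_pt_SP (g : nat -> R -> R) (n : nat) (t : R) :
  (forall k, continuity_pt (g k) t) -> continuity_pt (SP g n) t.
Proof.
  intros H. induction n as [|n IH].
  - exact (H 0%nat).
  - apply (continuity_pt_plus (SP g n) (g (S n))); auto.
Qed.

Lemma derivable_pt_lim_SP (f g : nat -> R -> R) (n : nat) (t : R) :
  (forall k, derivable_pt_lim (f k) t (g k t)) -> derivable_pt_lim (SP f n) t (SP g n t).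
Proof.
  intros H. induction n as [|n IH].
  - exact (H 0%nat).
  - apply (derivable_pt_lim_plus (SP f n) (f (S n))); auto.
Qed.

(** Weierstrass domination makes the series of derivatives converge uniformly. The half-line t > d
    reflects the singularity at 0 of the series to come, which are dominated only away from 0. *)
Lemma is_derive_series (f g : nat -> R -> R) (B : nat -> R) (F G : R -> R) (d : R) :
  (forall n t, d < t -> is_derive (f n) t (g n t)) ->
  (forall n t, d < t -> continuous (g n) t) ->
  (forall n t, d < t -> Rabs (g n t) <= B n) ->
  ex_series B ->
  (forall t, d < t -> is_series (fun n => f n t) (F t)) ->
  (forall t, d < t -> is_series (fun n => g n t) (G t)) ->
  forall t, d < t -> is_derive F t (G t).
Proof.
  intros D C HB [SB HS] HF HG t Ht. apply is_derive_Reals.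
  assert (Hr : 0 < t - d) by lra. set (r := mkposreal _ Hr).
  assert (Bd : forall y, Boule t r y -> d < y).
  { intros y Hy. unfold Boule in Hy. simpl in Hy. apply Rabs_def2 in Hy. lra. }
  assert (U : CVU (SP g) G t r).
  { intros eps He. apply is_series_Un_cv in HS. destruct (HS eps He) as [N HN]. exists N.
    intros n y Hn Hy. apply Bd in Hy.
    eapply Rle_lt_trans.
    - apply (sum_maj1 g B y (G y) SB n). apply (proj1 (is_series_Un_cv (fun n => g n y) (G y))). auto. exact HS.
      intros k. now apply HB.
    - specialize (HN n Hn). unfold Rdist in HN. apply Rabs_def2 in HN. lra. }
  apply (derivable_pt_lim_CVU (SP f) (SP g) F G t t r).
  - unfold Boule. rewrite Rminus_diag, Rabs_R0. apply cond_pos.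
  - intros y n Hy. apply Bd in Hy. apply derivable_pt_lim_SP. intros k. apply is_derive_Reals. auto.
  - intros y Hy. apply Bd in Hy. apply (proj1 (is_series_Un_cv (fun n => f n y) (F y))). auto.
  - exact U.
  - intros y Hy. apply (CVU_continuity (SP g) G t r U); auto.
    intros n z Hz. apply Bd in Hz. apply continuity_pt_SP. intros k.
    apply continuity_pt_filterlim. exact (C k z Hz).
Qed.

(** [P] gives convergence of the column sums and one inequality; applied to the transposed array it
    gives the reverse inequality. *)
Lemma is_series_tonelli (a : nat -> nat -> R) (r c : nat -> R) (s : R) :
  (forall i j, 0 <= a i j) ->
  (forall i, is_series (a i) (r i)) -> (forall j, is_series (fun i => a i j) (c j)) ->
  is_series r s -> is_series c s.
Proof.
  assert (P : forall (a : nat -> nat -> R) r c s, (forall i j, 0 <= a i j) ->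
    (forall i, is_series (a i) (r i)) -> (forall j, is_series (fun i => a i j) (c j)) ->
    is_series r s -> exists l, is_series c l /\ l <= s).
  { clear. intros a r c s Ha Hr Hc Hs.
    assert (Cp : forall j, 0 <= c j).
    { intros j. specialize (Hc j). apply is_series_Reals in Hc.
      refine (is_lim_seq_le (fun _ => 0) _ 0 (c j) _ (is_lim_seq_const _) (proj2 (is_lim_seq_Reals _ _) Hc)).
      intros n. apply cond_pos_sum. intros; apply Ha. }
    assert (Pa : forall J, is_series (fun i => sum_f_R0 (a i) J) (sum_f_R0 c J)).
    { induction J as [|J IH]; simpl. apply Hc. apply (is_series_plus _ _ _ _ IH (Hc (S J))). }
    assert (Le : forall J, sum_f_R0 c J <= s).
    { intros J. rewrite <- (is_series_unique _ _ (Pa J)), <- (is_series_unique _ _ Hs).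
      apply Series_le; [|now exists s]. intros i. split. apply cond_pos_sum. intros; apply Ha.
      apply sum_incr; auto. apply (proj1 (is_series_Reals (a i) (r i))), Hr. }
    assert (Ex : ex_finite_lim_seq (sum_f_R0 c)).
    { apply ex_finite_lim_seq_incr with s; auto. intros n. rewrite tech5. specialize (Cp (S n)). lra. }
    destruct Ex as [l Hl]. exists l. split.
    - apply is_series_Reals, is_lim_seq_Reals. exact Hl.
    - refine (is_lim_seq_le _ (fun _ => s) l s Le Hl (is_lim_seq_const _)). }
  intros Ha Hr Hc Hs. destruct (P a r c s Ha Hr Hc Hs) as (l & Hl & L1).
  destruct (P (fun j i => a i j) c r l) as (s' & Hs' & L2); auto.
  assert (E : s = s').
  { rewrite <- (is_series_unique _ _ Hs). now apply is_series_unique. }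
  replace s with l by lra. exact Hl.
Qed.

Lemma is_pseries_derive_unit (a : nat -> R) (f : R -> R) :
  (forall z, Rabs z < 1 -> is_pseries a z (f z)) ->
  forall z l, Rabs z < 1 -> is_derive f z l -> is_pseries (PS_derive a) z l.
Proof.
  intros H z l Hz Hl.
  assert (R1 : Rbar_lt (Rabs z) (CV_radius a)).
  (* Convergence at a point between |z| and 1 places [z] strictly inside the disk of convergence. *)
  { set (z' := (1 + Rabs z) / 2). assert (Hz0 := Rabs_pos z).
    assert (Hz' : Rabs z' < 1) by (unfold z'; rewrite Rabs_pos_eq; lra).
    apply Rbar_lt_le_trans with (Rabs z').
    - simpl. unfold z'. rewrite (Rabs_pos_eq ((1 + Rabs z) / 2)); lra.
    - apply Rbar_not_lt_le. intros L. apply (CV_disk_outside a z' L).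
      assert (E : ex_series (fun n => a n * z' ^ n)).
      { exists (f z'). apply is_series_ext with (2 := H z' Hz'). intros n.
        rewrite pow_n_pow. apply Rmult_comm. }
      now apply ex_series_lim_0. }
  assert (D := is_derive_PSeries a z R1).
  assert (D' : is_derive f z (PSeries (PS_derive a) z)).
  { apply is_derive_ext_loc with (2 := D).
    assert (O : locally z (fun y => Rabs y < 1)).
    { assert (Hp : 0 < 1 - Rabs z) by lra. exists (mkposreal _ Hp). intros y Hy.
      unfold ball in Hy; simpl in Hy; unfold AbsRing_ball, abs, minus, plus, opp in Hy; simpl in Hy.
      replace y with ((y + - z) + z) by ring. eapply Rle_lt_trans. apply Rabs_triang. lra. }
    apply filter_imp with (2 := O). intros y Hy. apply is_pseries_unique. auto. }
  rewrite <- (is_derive_unique _ _ _ Hl), (is_derive_unique _ _ _ D').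
  apply PSeries_correct. apply CV_radius_inside. now rewrite CV_radius_derive.
Qed.

Lemma is_series_pseries (a : nat -> R) (z l : R) : is_pseries a z l <-> is_series (fun n => a n * z ^ n) l.
Proof.
  split; intros H; refine (is_series_ext _ _ _ _ H); intros n.
  - rewrite <- pow_n_pow. apply Rmult_comm.
  - rewrite <- pow_n_pow. apply Rmult_comm.
Qed.

Lemma is_pseries_geom (z : R) : Rabs z < 1 -> is_pseries (fun _ => 1) z (/ (1 - z)).
Proof.
  intros Hz. apply is_series_pseries. apply is_series_ext with (fun n => z ^ n). intros n. symmetry. apply Rmult_1_l.
  now apply is_series_geom.
Qed.

Lemma is_pseries_geom_1 (z : R) : Rabs z < 1 -> is_pseries (PS_derive (fun _ => 1)) z (/ (1 - z) ^ 2).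
Proof.
  intros Hz. apply (is_pseries_derive_unit _ _ is_pseries_geom); auto.
  assert (B := Rabs_def2 _ _ Hz). auto_derive. lra. field. lra.
Qed.

Lemma is_pseries_geom_2 (z : R) : Rabs z < 1 ->
  is_pseries (PS_derive (PS_derive (fun _ => 1))) z (2 / (1 - z) ^ 3).
Proof.
  intros Hz. apply (is_pseries_derive_unit _ _ is_pseries_geom_1); auto.
  assert (B := Rabs_def2 _ _ Hz). auto_derive. nra. field. lra.
Qed.

Lemma is_series_nat_geom (z : R) : Rabs z < 1 -> is_series (fun n => INR (S n) * z ^ n) (/ (1 - z) ^ 2).
Proof.
  intros Hz. assert (H := is_pseries_geom_1 z Hz). apply is_series_pseries in H.
  refine (is_series_ext _ _ _ _ H). intros n. unfold PS_derive. now rewrite Rmult_1_r.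
Qed.

Lemma is_series_nat_sqr_geom (z : R) : Rabs z < 1 ->
  is_series (fun n => INR (S n) ^ 2 * z ^ n) ((1 + z) / (1 - z) ^ 3).
Proof.
  intros Hz. assert (B := Rabs_def2 _ _ Hz).
  assert (H := is_pseries_geom_2 z Hz). apply is_series_pseries in H.
  (* (n + 1)^2 = (n + 1)(n + 2) - (n + 1). *)
  assert (M := is_series_minus _ _ _ _ H (is_series_nat_geom z Hz)).
  replace ((1 + z) / (1 - z) ^ 3) with (plus (2 / (1 - z) ^ 3) (opp (/ (1 - z) ^ 2))).
  refine (is_series_ext _ _ _ _ M). intros n. unfold PS_derive, plus, opp; simpl plus; simpl opp.
  rewrite !S_INR. change (((INR n + 1) * ((INR n + 1 + 1) * 1) * z ^ n) + - ((INR n + 1) * z ^ n) = (INR n + 1) ^ 2 * z ^ n). ring.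
  change (2 / (1 - z) ^ 3 + - / (1 - z) ^ 2 = (1 + z) / (1 - z) ^ 3). field. lra.
Qed.

Lemma is_series_odd_geom (e : R) : 0 < e < 1 ->
  is_series (fun n => (2 * INR n + 1) * e ^ (2 * n + 1)) (e * (1 + e ^ 2) / (1 - e ^ 2) ^ 2).
Proof.
  intros He. assert (Hz : Rabs (e ^ 2) < 1) by (rewrite Rabs_pos_eq; nra).
  assert (A := is_series_scal_l (2 * e) _ _ (is_series_nat_geom _ Hz)).
  assert (B := is_series_scal_l (e) _ _ (is_series_geom _ Hz)).
  assert (M := is_series_minus _ _ _ _ A B).
  match type of M with is_series _ ?v => replace (e * (1 + e ^ 2) / (1 - e ^ 2) ^ 2) with v end.
  refine (is_series_ext _ _ _ _ M). intros n. rewrite S_INR, pow_add, (pow_mult e 2 n).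
  change (2 * e * ((INR n + 1) * (e ^ 2) ^ n) + - (e * (e ^ 2) ^ n) = (2 * INR n + 1) * ((e ^ 2) ^ n * e ^ 1)). ring.
  change (2 * e * / (1 - e ^ 2) ^ 2 + - (e * / (1 - e ^ 2)) = e * (1 + e ^ 2) / (1 - e ^ 2) ^ 2).
  field. nra.
Qed.

(** * The logarithm of theta_4 and its two derivatives *)

(** Minus the logarithm of factor [S n] of the product, that is ln coth ((n + 1) t / 2), written in
    exponentials to match [gauss_prod]. *)
Definition log_factor (n : nat) (t : R) : R :=
  ln ((1 + exp (- (INR (S n) * t))) / (1 - exp (- (INR (S n) * t)))).
Definition log_factor' (n : nat) (t : R) : R := - INR (S n) / sinh (INR (S n) * t).
Definition log_factor'' (n : nat) (t : R) : R :=
  INR (S n) ^ 2 * cosh (INR (S n) * t) / sinh (INR (S n) * t) ^ 2.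

Lemma exp_neg_unit (s : R) : 0 < s -> 0 < exp (- s) < 1.
Proof. intros Hs. split. apply exp_pos. rewrite <- exp_0. apply exp_increasing. lra. Qed.

Lemma sinh_exp_neg (s : R) : sinh s = (1 - exp (- s) ^ 2) / (2 * exp (- s)).
Proof.
  unfold sinh. assert (P := exp_pos (- s)). replace (exp s) with (/ exp (- s)).
  field; lra. rewrite exp_Ropp, Rinv_inv. reflexivity.
Qed.

Lemma cosh_exp_neg (s : R) : cosh s = (1 + exp (- s) ^ 2) / (2 * exp (- s)).
Proof.
  unfold cosh. assert (P := exp_pos (- s)). replace (exp s) with (/ exp (- s)).
  field; lra. rewrite exp_Ropp, Rinv_inv. reflexivity.
Qed.

Lemma sinh_pos (s : R) : 0 < s -> 0 < sinh s.
Proof.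
  intros Hs. assert (E := exp_neg_unit s Hs). rewrite sinh_exp_neg.
  apply Rdiv_lt_0_compat; nra.
Qed.

Lemma INR_S_pos (n : nat) : 0 < INR (S n).
Proof. apply lt_0_INR. lia. Qed.

Lemma exp_neg_INR (n : nat) (t : R) : exp (- (INR n * t)) = exp (- t) ^ n.
Proof.
  induction n as [|n IH]. simpl. rewrite Rmult_0_l, Ropp_0. apply exp_0.
  rewrite <- tech_pow_Rmult, <- IH, <- exp_plus. f_equal. rewrite S_INR. ring.
Qed.

Lemma is_derive_log_factor (n : nat) (t : R) : 0 < t -> is_derive (log_factor n) t (log_factor' n t).
Proof.
  intros Ht. assert (C := INR_S_pos n). unfold log_factor, log_factor'.
  set (c := INR (S n)) in *. assert (Hct : 0 < c * t) by now apply Rmult_lt_0_compat.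
  assert (E := exp_neg_unit _ Hct). rewrite sinh_exp_neg.
  auto_derive. split. lra. split; auto. apply Rdiv_lt_0_compat; lra.
  set (e := exp (- (c * t))) in *. field. repeat split; nra.
Qed.

Lemma is_derive_sinh (x : R) : is_derive sinh x (cosh x).
Proof. apply is_derive_Reals, derivable_pt_lim_sinh. Qed.

Lemma is_derive_log_factor' (n : nat) (t : R) : 0 < t -> is_derive (log_factor' n) t (log_factor'' n t).
Proof.
  intros Ht. assert (C := INR_S_pos n). unfold log_factor', log_factor''.
  set (c := INR (S n)) in *. assert (Hct : 0 < c * t) by now apply Rmult_lt_0_compat.
  assert (E := sinh_pos _ Hct).
  assert (D : is_derive (fun t => sinh (c * t)) t (c * cosh (c * t))).
  { apply (is_derive_comp sinh (fun t => c * t)). apply is_derive_sinh. auto_derive; auto. ring. }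
  assert (D2 := is_derive_scal _ t (- c) _ (is_derive_inv _ t _ D (Rgt_not_eq _ _ E))).
  replace (c ^ 2 * cosh (c * t) / sinh (c * t) ^ 2) with (- c * (- (c * cosh (c * t)) / sinh (c * t) ^ 2))
    by (field; lra).
  exact D2.
Qed.

Lemma continuous_log_factor'' (n : nat) (t : R) : 0 < t -> continuous (log_factor'' n) t.
Proof.
  intros Ht. assert (C := INR_S_pos n).
  assert (Hct : 0 < INR (S n) * t) by now apply Rmult_lt_0_compat.
  assert (E := sinh_pos _ Hct).
  apply (ex_derive_continuous (log_factor'' n)). unfold log_factor'', sinh, cosh in *.
  auto_derive. apply Rgt_not_eq. rewrite Rmult_1_r. now apply Rmult_lt_0_compat.
Qed.

(** With e = exp (- c t) the terms are 2 c e / (1 - e^2) and 2 c^2 e (1 + e^2) / (1 - e^2)^2. Now e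
    <= exp (- d)^(n+1), 1 - e^2 >= 1 - exp (- d), and 1 + e^2 <= 2. *)
Lemma log_factor_bounds (n : nat) (d t : R) : 0 < d -> d < t ->
  Rabs (log_factor' n t) <= 2 * exp (- d) / (1 - exp (- d)) * (INR (S n) * exp (- d) ^ n) /\
  Rabs (log_factor'' n t) <= 4 * exp (- d) / (1 - exp (- d)) ^ 2 * (INR (S n) ^ 2 * exp (- d) ^ n).
Proof.
  intros Hd Ht. assert (C := INR_S_pos n). unfold log_factor', log_factor''.
  assert (Z := exp_neg_unit d Hd). assert (Hz : Rabs (exp (- d)) < 1) by (rewrite Rabs_pos_eq; lra).
  assert (Ez : exp (- (INR (S n) * t)) <= exp (- d) ^ S n).
  { rewrite <- exp_neg_INR. left. apply exp_increasing. nra. }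
  set (z := exp (- d)) in *. set (c := INR (S n)) in *.
  assert (Hct : 0 < c * t) by (apply Rmult_lt_0_compat; lra).
  assert (E := exp_neg_unit _ Hct). rewrite sinh_exp_neg, cosh_exp_neg.
  set (e := exp (- (c * t))) in *.
  assert (Zn : 0 < z ^ n <= 1).
  { split. apply pow_lt; lra. rewrite <- (pow1 n). apply pow_incr; lra. }
  rewrite <- tech_pow_Rmult in Ez.
  assert (e <= z) by nra. assert (W : 1 - z <= 1 - e ^ 2) by nra.
  split.
  - replace (- c / ((1 - e ^ 2) / (2 * e))) with (- (2 * c * e * / (1 - e ^ 2))) by (field; nra).
    rewrite Rabs_Ropp, Rabs_pos_eq.
    2:{ apply Rmult_le_pos. apply Rmult_le_pos; lra. left; apply Rinv_0_lt_compat; lra. }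
    replace (2 * z / (1 - z) * (c * z ^ n)) with (2 * c * (z * z ^ n) * / (1 - z)) by (field; lra).
    apply Rmult_le_compat. apply Rmult_le_pos; lra. left; apply Rinv_0_lt_compat; lra.
    apply Rmult_le_compat_l; lra. apply Rinv_le_contravar; lra.
  - replace (c ^ 2 * ((1 + e ^ 2) / (2 * e)) / ((1 - e ^ 2) / (2 * e)) ^ 2) with
      (c ^ 2 * (2 * e * (1 + e ^ 2)) * / (1 - e ^ 2) ^ 2) by (field; nra).
    assert (C2 : 0 < c ^ 2) by now apply pow_lt.
    assert (I2 : 0 < (1 - e ^ 2) ^ 2) by (apply pow_lt; lra).
    rewrite Rabs_pos_eq.
    2:{ apply Rmult_le_pos. apply Rmult_le_pos; nra. left; now apply Rinv_0_lt_compat. }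
    replace (4 * z / (1 - z) ^ 2 * (c ^ 2 * z ^ n)) with (c ^ 2 * (4 * (z * z ^ n)) * / (1 - z) ^ 2) by (field; lra).
    apply Rmult_le_compat. apply Rmult_le_pos; nra. left; now apply Rinv_0_lt_compat.
    apply Rmult_le_compat_l. lra. nra. apply Rinv_le_contravar. apply pow_lt; lra.
    apply pow_incr; lra.
Qed.

Lemma ex_series_log_factor_bounds (d A : R) : 0 < d ->
  ex_series (fun n => A * (INR (S n) * exp (- d) ^ n)) /\
  ex_series (fun n => A * (INR (S n) ^ 2 * exp (- d) ^ n)).
Proof.
  intros Hd. assert (Z := exp_neg_unit d Hd).
  assert (Hz : Rabs (exp (- d)) < 1) by (rewrite Rabs_pos_eq; lra).
  split.
  - exists (A * (/ (1 - exp (- d)) ^ 2)). exact (is_series_scal_l A _ _ (is_series_nat_geom _ Hz)).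
  - eexists. exact (is_series_scal_l A _ _ (is_series_nat_sqr_geom _ Hz)).
Qed.

Definition log_theta (t : R) : R := - ln (theta_lim (exp (- t))).
Definition log_theta' (t : R) : R := Series (fun n => log_factor' n t).
Definition log_theta'' (t : R) : R := Series (fun n => log_factor'' n t).

Lemma is_series_log_theta (t : R) : 0 < t -> is_series (fun n => log_factor n t) (log_theta t).
Proof.
  intros Ht. assert (Z := exp_neg_unit t Ht).
  assert (Hz : Rabs (exp (- t)) < 1) by (rewrite Rabs_pos_eq; lra).
  assert (Hz0 : 0 <= exp (- t) < 1) by lra. assert (P := theta_lim_pos _ Hz0).
  destruct (is_lim_gauss_theta _ Hz) as [L _]. apply is_lim_seq_incr_1 in L.
  apply is_series_Un_cv, is_lim_seq_Reals.
  apply is_lim_seq_ext with (fun n => - ln (gauss_prod (exp (- t)) (S n))).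
  - intros n. induction n as [|n IH].
    + cbn [sum_f_R0 gauss_prod]. unfold log_factor. rewrite exp_neg_INR.
      assert (Q := one_minus_pow_pos _ 0 Hz). assert (Q2 := one_plus_pow_pos _ 1 Hz).
      rewrite Rmult_1_l, <- ln_Rinv by now apply Rdiv_lt_0_compat. f_equal. field. lra.
    + rewrite tech5, <- IH. set (x := gauss_prod (exp (- t)) (S n)).
      assert (X : 0 < x) by now apply gauss_prod_pos.
      change (gauss_prod (exp (- t)) (S (S n))) with
        (x * ((1 - exp (- t) ^ S (S n)) / (1 + exp (- t) ^ S (S n)))).
      assert (Q := one_minus_pow_pos _ (S n) Hz). assert (Q2 := one_plus_pow_pos _ (S (S n)) Hz).
      unfold log_factor. rewrite exp_neg_INR. rewrite ln_mult, !ln_div; auto; try lra.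
      now apply Rdiv_lt_0_compat.
  - unfold log_theta. apply (is_lim_seq_continuous (fun x => - ln x)); auto.
    apply continuity_pt_opp. apply derivable_continuous_pt. exists (/ theta_lim (exp (- t))).
    apply derivable_pt_lim_ln. lra.
Qed.

Lemma is_series_log_theta' (t : R) : 0 < t -> is_series (fun n => log_factor' n t) (log_theta' t).
Proof.
  intros Ht. assert (Hd : 0 < t / 2) by lra. apply Series_correct.
  apply (ex_series_le (K := R_AbsRing) (V := R_CompleteNormedModule)) with
    (2 := proj1 (ex_series_log_factor_bounds (t / 2) (2 * exp (- (t / 2)) / (1 - exp (- (t / 2)))) Hd)).
  intros n. apply (log_factor_bounds n (t / 2) t); lra.
Qed.

Lemma is_series_log_theta'' (t : R) : 0 < t -> is_series (fun n => log_factor'' n t) (log_theta'' t).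
Proof.
  intros Ht. assert (Hd : 0 < t / 2) by lra. apply Series_correct.
  apply (ex_series_le (K := R_AbsRing) (V := R_CompleteNormedModule)) with
    (2 := proj2 (ex_series_log_factor_bounds (t / 2) (4 * exp (- (t / 2)) / (1 - exp (- (t / 2))) ^ 2) Hd)).
  intros n. apply (log_factor_bounds n (t / 2) t); lra.
Qed.

Lemma is_derive_log_theta (t : R) : 0 < t -> is_derive log_theta t (log_theta' t).
Proof.
  intros Ht. assert (Hd : 0 < t / 2) by lra.
  apply (is_derive_series log_factor log_factor' _ log_theta log_theta' (t / 2)) with
    (4 := proj1 (ex_series_log_factor_bounds (t / 2) (2 * exp (- (t / 2)) / (1 - exp (- (t / 2)))) Hd)).
  - intros n s Hs. apply is_derive_log_factor; lra.
  - intros n s Hs. apply (ex_derive_continuous (log_factor' n)). eexists. apply is_derive_log_factor'; lra.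
  - intros n s Hs. now apply (log_factor_bounds n (t / 2) s).
  - intros s Hs. apply is_series_log_theta; lra.
  - intros s Hs. apply is_series_log_theta'; lra.
  - lra.
Qed.

Lemma is_derive_log_theta' (t : R) : 0 < t -> is_derive log_theta' t (log_theta'' t).
Proof.
  intros Ht. assert (Hd : 0 < t / 2) by lra.
  apply (is_derive_series log_factor' log_factor'' _ log_theta' log_theta'' (t / 2)) with
    (4 := proj2 (ex_series_log_factor_bounds (t / 2) (4 * exp (- (t / 2)) / (1 - exp (- (t / 2))) ^ 2) Hd)).
  - intros n s Hs. apply is_derive_log_factor'; lra.
  - intros n s Hs. apply continuous_log_factor''; lra.
  - intros n s Hs. now apply (log_factor_bounds n (t / 2) s).
  - intros s Hs. apply is_series_log_theta'; lra.
  - intros s Hs. apply is_series_log_theta''; lra.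
  - lra.
Qed.

(** * Passage from y to the parameter m *)

Lemma is_derive_ell_ratio (m : R) : 0 < m < 1 ->
  is_derive ell_ratio m (- PI ^ 2 / (4 * m * (1 - m) * ellK m ^ 2)).
Proof.
  intros Hm. assert (DK := is_derive_ellK m Hm). assert (Hm' : 0 < 1 - m < 1) by lra.
  assert (DK' := is_derive_reflect _ _ _ (is_derive_ellK _ Hm')).
  assert (K0 : 0 < ellK m) by (apply ellK_pos; lra).
  assert (D := is_derive_div _ _ _ _ _ (is_derive_scal _ _ PI _ DK') DK (Rgt_not_eq _ _ K0)).
  assert (Lg := legendre_relation m Hm). unfold legendre in Lg.
  match type of D with is_derive _ _ ?v =>
    replace (- PI ^ 2 / (4 * m * (1 - m) * ellK m ^ 2)) with v; [exact D|] end.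
  replace (1 - (1 - m)) with m by ring.
  (* The quotient rule leaves Legendre's combination in the numerator, so a factor PI / 2 is exposed
     to be replaced by it. *)
  replace (- PI ^ 2 / (4 * m * (1 - m) * ellK m ^ 2)) with
    (- PI * (PI / 2) / (2 * m * (1 - m) * ellK m ^ 2)) by (field; lra).
  rewrite <- Lg. field. lra.
Qed.

Lemma locally_unit (m : R) : 0 < m < 1 -> locally m (fun y => 0 < y < 1).
Proof.
  intros Hm. apply (open_and (fun y => 0 < y) (fun y => y < 1)); auto. apply open_gt. apply open_lt.
Qed.

Lemma log_theta_ell_ratio (m : R) : 0 < m < 1 ->
  log_theta (ell_ratio m) = - ln (2 * sqrt (1 - m) * ellK m / PI) / 2.
Proof.
  intros Hm. unfold log_theta. rewrite <- (theta_lim_sqr_ellK m Hm).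
  assert (Z := exp_neg_unit _ (ell_ratio_pos m Hm)).
  assert (Hz0 : 0 <= exp (- ell_ratio m) < 1) by lra. assert (P := theta_lim_pos _ Hz0).
  replace (theta_lim _ ^ 2) with (theta_lim (exp (- ell_ratio m)) * theta_lim (exp (- ell_ratio m))) by ring.
  rewrite ln_mult by lra. field.
Qed.

(** The identity for [log_theta (ell_ratio m)] is differentiated in [m] on both sides, and the
    nonzero derivative of [ell_ratio] is cancelled. The second derivative is obtained in the same
    way. *)
Lemma log_theta'_ell_ratio (m : R) : 0 < m < 1 ->
  log_theta' (ell_ratio m) = (ellE m - ellK m) * ellK m / PI ^ 2.
Proof.
  intros Hm. assert (HP := PI_RGT_0). assert (K0 : 0 < ellK m) by (apply ellK_pos; lra).
  assert (D := is_derive_comp log_theta ell_ratio m _ _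
    (is_derive_log_theta _ (ell_ratio_pos m Hm)) (is_derive_ell_ratio m Hm)).
  assert (DK := is_derive_ellK m Hm).
  assert (S0 : 0 < sqrt (1 - m)) by (apply sqrt_lt_R0; lra).
  assert (S2 : sqrt (1 - m) * sqrt (1 - m) = 1 - m) by (apply sqrt_sqrt; lra).
  assert (X0 : 0 < 2 * sqrt (1 - m) * ellK m / PI).
  { apply Rdiv_lt_0_compat; auto. repeat apply Rmult_lt_0_compat; lra. }
  assert (D2 : is_derive (fun m => - ln (2 * sqrt (1 - m) * ellK m / PI) / 2) m
    ((1 - ellE m / ellK m) / (4 * m * (1 - m)))).
  { auto_derive. repeat split; auto. lra. eexists; exact DK.
    change (Derive (fun x : R => ellK x) m) with (Derive ellK m).
    rewrite (is_derive_unique _ _ _ DK). change (1 + - m) with (1 - m).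
    clear - S0 S2 K0 Hm HP. set (s := sqrt (1 - m)) in *. set (K := ellK m) in *.
    (* Expressing [m] through the root leaves an identity of rational functions in s, K and E. *)
    set (E := ellE m). clearbody s K E. assert (M : m = 1 - s * s) by lra. subst m.
    field. repeat split; try lra; nra. }
  assert (D3 := is_derive_ext_loc _ _ _ _ (filter_imp _ _ (fun y Hy => eq_sym (log_theta_ell_ratio y Hy)) (locally_unit m Hm)) D2).
  assert (U := eq_trans (eq_sym (is_derive_unique _ _ _ D3)) (is_derive_unique _ _ _ D)).
  match type of U with _ = scal ?x ?y => change (scal x y) with (x * y) in U end.
  apply Rmult_eq_reg_l with (- PI ^ 2 / (4 * m * (1 - m) * ellK m ^ 2)).
  rewrite <- U. field. lra.
  assert (0 < 4 * m * (1 - m) * ellK m ^ 2) by (repeat apply Rmult_lt_0_compat; try lra; now apply pow_lt).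
  assert (0 < PI ^ 2) by now apply pow_lt.
  apply Rlt_not_eq. unfold Rdiv. rewrite Ropp_mult_distr_l_reverse.
  apply Ropp_lt_gt_0_contravar. now apply Rdiv_lt_0_compat.
Qed.

Lemma log_theta''_ell_ratio (m : R) : 0 < m < 1 ->
  log_theta'' (ell_ratio m) = 2 * ellK m ^ 2 / PI ^ 4 * (m * ellK m ^ 2 - (ellK m - ellE m) ^ 2).
Proof.
  intros Hm. assert (HP := PI_RGT_0). assert (K0 : 0 < ellK m) by (apply ellK_pos; lra).
  assert (D := is_derive_comp log_theta' ell_ratio m _ _
    (is_derive_log_theta' _ (ell_ratio_pos m Hm)) (is_derive_ell_ratio m Hm)).
  assert (DK := is_derive_ellK m Hm). assert (DE := is_derive_ellE m Hm).
  assert (D2 : is_derive (fun m => (ellE m - ellK m) * ellK m / PI ^ 2) m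
    (((ellK m - ellE m) ^ 2 - m * ellK m ^ 2) / (2 * m * (1 - m) * PI ^ 2))).
  { auto_derive. repeat split; auto; eexists; [exact DE|exact DK|exact DK].
    change (Derive (fun x : R => ellK x) m) with (Derive ellK m).
    change (Derive (fun x : R => ellE x) m) with (Derive ellE m).
    rewrite (is_derive_unique _ _ _ DK), (is_derive_unique _ _ _ DE). field. lra. }
  assert (D3 := is_derive_ext_loc _ _ _ _ (filter_imp _ _ (fun y Hy => eq_sym (log_theta'_ell_ratio y Hy)) (locally_unit m Hm)) D2).
  assert (U := eq_trans (eq_sym (is_derive_unique _ _ _ D3)) (is_derive_unique _ _ _ D)).
  match type of U with _ = scal ?x ?y => change (scal x y) with (x * y) in U end.
  apply Rmult_eq_reg_l with (- PI ^ 2 / (4 * m * (1 - m) * ellK m ^ 2)).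
  rewrite <- U. field. lra.
  assert (0 < 4 * m * (1 - m) * ellK m ^ 2) by (repeat apply Rmult_lt_0_compat; try lra; now apply pow_lt).
  assert (0 < PI ^ 2) by now apply pow_lt.
  apply Rlt_not_eq. unfold Rdiv. rewrite Ropp_mult_distr_l_reverse.
  apply Ropp_lt_gt_0_contravar. now apply Rdiv_lt_0_compat.
Qed.

(** * Equality of the two hyperbolic sums *)

Lemma is_series_cosh_div_sinh2 (s : R) : 0 < s ->
  is_series (fun i => 2 * ((2 * INR i + 1) * exp (- s) ^ (2 * i + 1))) (cosh s / sinh s ^ 2).
Proof.
  intros Hs. assert (E := exp_neg_unit s Hs).
  assert (H := is_series_scal_l 2 _ _ (is_series_odd_geom _ E)).
  replace (cosh s / sinh s ^ 2) with (mult 2 (exp (- s) * (1 + exp (- s) ^ 2) / (1 - exp (- s) ^ 2) ^ 2)).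
  exact H. rewrite cosh_exp_neg, sinh_exp_neg. set (e := exp (- s)) in *.
  change (2 * (e * (1 + e ^ 2) / (1 - e ^ 2) ^ 2) =
    (1 + e ^ 2) / (2 * e) / ((1 - e ^ 2) / (2 * e)) ^ 2). field. nra.
Qed.

Lemma is_series_cosh_div_sinh3 (s : R) : 0 < s ->
  is_series (fun j => 4 * exp (- s) ^ 2 * (INR (S j) ^ 2 * (exp (- s) ^ 2) ^ j)) (cosh s / sinh s ^ 3).
Proof.
  intros Hs. assert (E := exp_neg_unit s Hs).
  assert (Hz : Rabs (exp (- s) ^ 2) < 1) by (rewrite Rabs_pos_eq; nra).
  assert (H := is_series_scal_l (4 * exp (- s) ^ 2) _ _ (is_series_nat_sqr_geom _ Hz)).
  replace (cosh s / sinh s ^ 3) with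
    (mult (4 * exp (- s) ^ 2) ((1 + exp (- s) ^ 2) / (1 - exp (- s) ^ 2) ^ 3)).
  exact H. rewrite cosh_exp_neg, sinh_exp_neg. set (e := exp (- s)) in *.
  change (4 * e ^ 2 * ((1 + e ^ 2) / (1 - e ^ 2) ^ 3) =
    (1 + e ^ 2) / (2 * e) / ((1 - e ^ 2) / (2 * e)) ^ 3). field. nra.
Qed.

(* Both sums are iterated sums of [4 (j+1)^2 (2i+1) exp(-(2i+1)(j+1)y)]. *)
Lemma is_series_sinh2_sinh3 (y S0 : R) : 0 < y ->
  is_series (fun n => 2 * (INR (S n) ^ 2 * cosh (INR (S n) * y) / sinh (INR (S n) * y) ^ 2)) S0 ->
  is_series (fun n => (2 * INR (S n) - 1) * cosh ((2 * INR (S n) - 1) * y / 2)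
     / sinh ((2 * INR (S n) - 1) * y / 2) ^ 3) S0.
Proof.
  intros Hy.
  apply (is_series_tonelli (fun j i => 4 * INR (S j) ^ 2 * (2 * INR i + 1) * exp (- y) ^ (S j * (2 * i + 1)))).
  - intros j i. assert (P := pow_lt (exp (- y)) (S j * (2 * i + 1)) (exp_pos _)).
    assert (H := pos_INR i). assert (H2 := pow2_ge_0 (INR (S j))).
    apply Rmult_le_pos; [apply Rmult_le_pos; [apply Rmult_le_pos|]|]; lra.
  - intros j. assert (C := INR_S_pos j). assert (Hs : 0 < INR (S j) * y) by now apply Rmult_lt_0_compat.
    assert (H := is_series_scal_l (2 * INR (S j) ^ 2) _ _ (is_series_cosh_div_sinh2 _ Hs)).
    match type of H with is_series _ ?v =>
      replace (2 * (INR (S j) ^ 2 * cosh (INR (S j) * y) / sinh (INR (S j) * y) ^ 2)) with v end.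
    + refine (is_series_ext _ _ _ _ H). intros i. rewrite exp_neg_INR, <- pow_mult.
      match goal with |- scal ?x ?y = ?z => change (x * y = z) end. ring.
    + match goal with |- scal ?x ?y = ?z => change (x * y = z) end. unfold Rdiv. ring.
  - intros i. assert (C := INR_S_pos i). rewrite S_INR in *.
    replace (2 * (INR i + 1) - 1) with (2 * INR i + 1) by ring.
    assert (H0 := pos_INR i).
    assert (Hs : 0 < (2 * INR i + 1) * y / 2) by (assert (0 < (2 * INR i + 1) * y) by (apply Rmult_lt_0_compat; lra); lra).
    assert (H := is_series_scal_l (2 * INR i + 1) _ _ (is_series_cosh_div_sinh3 _ Hs)).
    match type of H with is_series _ ?v =>
      replace ((2 * INR i + 1) * cosh ((2 * INR i + 1) * y / 2) / sinh ((2 * INR i + 1) * y / 2) ^ 3) with v end.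
    + refine (is_series_ext _ _ _ _ H). intros j.
      (* The half argument in the second sum is undone here: its expansion involves only the square
         of the exponential. *)
      assert (X : exp (- ((2 * INR i + 1) * y / 2)) ^ 2 = exp (- y) ^ (2 * i + 1)).
      { rewrite <- !exp_neg_INR. f_equal. rewrite plus_INR, mult_INR. simpl. field. }
      rewrite X, (Nat.mul_comm (S j)), (pow_mult _ (2 * i + 1) (S j)).
      rewrite <- (tech_pow_Rmult (exp (- y) ^ (2 * i + 1)) j).
      match goal with |- scal ?x ?y = ?z => change (x * y = z) end. ring.
    + match goal with |- scal ?x ?y = ?z => change (x * y = z) end. unfold Rdiv. ring.
Qed.

(** * From the improper integrals to K and E, and the conclusion *)

(** The substitution t = sin p removes the singularity at t = 1: [g] is continuous up to PI / 2, so
    its integral to [p] tends to the full one while sin p tends to 1. *)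
Lemma improper_int_sin_subst (f g : R -> R) (v : R) :
  (forall t, 0 <= t < 1 -> continuous f t) -> (forall p, continuous g p) ->
  (forall p, 0 <= p < PI / 2 -> cos p * f (sin p) = g p) ->
  improper_int_0_1 f v -> v = RInt g 0 (PI / 2).
Proof.
  intros Cf Cg Hfg [Hi Hl]. assert (HP := PI_RGT_0).
  assert (Ig : forall a b, ex_RInt g a b).
  { intros. apply (ex_RInt_continuous (V := R_CompleteNormedModule)). auto. }
  assert (Sb : forall p, 0 <= p < PI / 2 -> 0 <= sin p < 1).
  { intros p Hp. split. apply sin_ge_0; lra. rewrite <- sin_PI2. apply sin_increasing_1; lra. }
  assert (E : forall p, 0 <= p < PI / 2 -> RInt f 0 (sin p) = RInt g 0 p).
  { intros p Hp.
    assert (I : is_RInt (fun y => scal (cos y) (f (sin y))) 0 p (RInt f (sin 0) (sin p))).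
    { apply (is_RInt_comp f sin cos).
      - rewrite Rmin_left, Rmax_right by lra. intros x Hx. apply Cf, Sb. lra.
      - intros x _. split. apply is_derive_Reals, derivable_pt_lim_sin.
        apply (ex_derive_continuous cos). auto_derive. auto. }
    rewrite sin_0 in I. rewrite <- (is_RInt_unique (V := R_CompleteNormedModule) _ _ _ _ I).
    apply RInt_ext. rewrite Rmin_left, Rmax_right by lra. intros x Hx. apply Hfg. lra. }
  destruct (Req_dec v (RInt g 0 (PI / 2))) as [|N]; auto. exfalso.
  assert (P : 0 < Rabs (RInt g 0 (PI / 2) - v)) by (apply Rabs_pos_lt; lra).
  set (e := Rabs (RInt g 0 (PI / 2) - v)) in *.
  destruct (Hl (e / 2)) as (d & Hd & H). lra.
  assert (C1 : continuous (fun p => RInt g 0 p) (PI / 2)).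
  { apply (ex_derive_continuous (fun p => RInt g 0 p)). exists (g (PI / 2)).
    apply (is_derive_RInt g _ 0). apply filter_forall. intros y. apply (RInt_correct (V := R_CompleteNormedModule)), Ig. apply Cg. }
  assert (C2 : continuous sin (PI / 2)) by (apply (ex_derive_continuous sin); auto_derive; auto).
  assert (He : 0 < e / 2) by lra.
  assert (L1 := proj1 (filterlim_locally _ _) C1 (mkposreal _ He)).
  assert (L2 := proj1 (filterlim_locally _ _) C2 (mkposreal _ Hd)).
  destruct (filter_and _ _ L1 L2) as [r Hr].
  (* Within [r] of PI / 2, the integral of [g] up to [p] misses less than e / 2 and sin p exceeds 1
     - d; the bound PI / 4 keeps [p] nonnegative. *)
  set (p := PI / 2 - Rmin (r / 2) (PI / 4)).
  assert (M1 := Rmin_l (r / 2) (PI / 4)). assert (M2 := Rmin_r (r / 2) (PI / 4)).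
  assert (M3 : 0 < Rmin (r / 2) (PI / 4)) by (apply Rmin_glb_lt; [assert (X := cond_pos r)|]; lra).
  assert (Hp : 0 <= p < PI / 2) by (unfold p; lra).
  assert (Bp : ball (PI / 2) r p).
  { change (Rabs (p - PI / 2) < r). assert (X := cond_pos r). unfold p. apply Rabs_def1; lra. }
  destruct (Hr p Bp) as [B1 B2].
  change (Rabs (RInt g 0 p - RInt g 0 (PI / 2)) < e / 2) in B1.
  change (Rabs (sin p - sin (PI / 2)) < d) in B2. rewrite sin_PI2 in B2.
  destruct (Hi (sin p) (Sb p Hp)) as [pr].
  assert (B3 := H (sin p) pr (Sb p Hp)).
  rewrite <- RInt_Reals, E in B3 by auto.
  assert (B4 : 1 - d < sin p) by (apply Rabs_def2 in B2; lra).
  specialize (B3 B4).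
  assert (T := Rabs_triang (RInt g 0 (PI / 2) - RInt g 0 p) (RInt g 0 p - v)).
  rewrite (Rabs_minus_sym (RInt g 0 (PI / 2))) in T.
  replace (RInt g 0 (PI / 2) - RInt g 0 p + (RInt g 0 p - v)) with (RInt g 0 (PI / 2) - v) in T by ring.
  fold e in T. lra.
Qed.

Lemma cos_eq_sqrt (p : R) : 0 <= p < PI / 2 -> 0 < cos p /\ 1 - sin p ^ 2 = cos p ^ 2.
Proof.
  intros Hp. split. apply cos_gt_0; lra. assert (H := sin2_add_cos2 p). lra.
Qed.

Lemma is_K_ellK (k v : R) : 0 < k < 1 -> is_K k v -> v = ellK (k ^ 2).
Proof.
  intros Hk. assert (Hm : k ^ 2 < 1) by nra. apply improper_int_sin_subst.
  - intros t Ht. apply (ex_derive_continuous (K_integrand k)). unfold K_integrand.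
    assert (H : 0 < (1 - t ^ 2) * (1 - k ^ 2 * t ^ 2)) by (apply Rmult_lt_0_compat; nra).
    auto_derive. split. exact H. split; auto. apply Rgt_not_eq, sqrt_lt_R0, H.
  - intros p. now apply continuous_inv_sqrt_modular.
  - intros p Hp. destruct (cos_eq_sqrt p Hp) as [C E]. unfold K_integrand.
    fold (modular (k ^ 2) p). assert (W := modular_pos (k ^ 2) p Hm). assert (S := sqrt_lt_R0 _ W).
    rewrite E, sqrt_mult_alt by apply pow2_ge_0. rewrite sqrt_pow2 by lra. field. lra.
Qed.

Lemma is_E_ellE (k v : R) : 0 < k < 1 -> is_E k v -> v = ellE (k ^ 2).
Proof.
  intros Hk. assert (Hm : k ^ 2 < 1) by nra. apply improper_int_sin_subst.
  - intros t Ht. apply (ex_derive_continuous (E_integrand k)). unfold E_integrand.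
    assert (H : 0 < 1 - t ^ 2) by nra.
    assert (H1 : 0 < 1 - k ^ 2 * t ^ 2) by nra.
    auto_derive. split. apply Rgt_not_eq, H. split; auto. now apply Rdiv_lt_0_compat.
  - intros p. now apply continuous_sqrt_modular.
  - intros p Hp. destruct (cos_eq_sqrt p Hp) as [C E]. unfold E_integrand.
    fold (modular (k ^ 2) p). assert (W := modular_pos (k ^ 2) p Hm).
    rewrite E, sqrt_div_alt by now apply pow_lt. rewrite sqrt_pow2 by lra. field. lra.
Qed.

Theorem theorem1 (x k Kk Kk' Ek : R) :
  0 < x -> 0 < k < 1 ->
  is_K k Kk -> is_K (kprime k) Kk' -> is_E k Ek ->
  x = Kk' / Kk ->
  let RHS := 4 / PI ^ 4 * Kk ^ 2 * (k ^ 2 * Kk ^ 2 - (Kk - Ek) ^ 2) in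
  infinite_sum
    (fun n => 2 * (INR (S n) ^ 2 * cosh (PI * INR (S n) * x)
                   / sinh (PI * INR (S n) * x) ^ 2)) RHS /\
  infinite_sum
    (fun n => (2 * INR (S n) - 1) * cosh (PI * (2 * INR (S n) - 1) * x / 2)
              / sinh (PI * (2 * INR (S n) - 1) * x / 2) ^ 3) RHS.
Proof.
  intros Hx Hk HK HK' HE Ex RHS. assert (HP := PI_RGT_0).
  assert (Hm : 0 < k ^ 2 < 1) by nra.
  assert (Hk' : 0 < kprime k < 1).
  { unfold kprime. split. apply sqrt_lt_R0; lra. rewrite <- sqrt_1 at 2. apply sqrt_lt_1_alt; lra. }
  apply is_K_ellK in HK; auto. apply is_K_ellK in HK'; auto. apply is_E_ellE in HE; auto.
  unfold kprime in HK'. rewrite pow2_sqrt in HK' by lra.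
  assert (Ey : PI * x = ell_ratio (k ^ 2)).
  { unfold ell_ratio. rewrite Ex, HK, HK'. unfold Rdiv. ring. }
  assert (Hy : 0 < PI * x) by now apply Rmult_lt_0_compat.
  assert (S1 : is_series (fun n => 2 * (INR (S n) ^ 2 * cosh (INR (S n) * (PI * x)) / sinh (INR (S n) * (PI * x)) ^ 2)) RHS).
  { assert (H := is_series_scal_l 2 _ _ (is_series_log_theta'' _ Hy)).
    rewrite Ey, log_theta''_ell_ratio, <- Ey in H by auto.
    replace RHS with (scal 2 (2 * ellK (k ^ 2) ^ 2 / PI ^ 4 * (k ^ 2 * ellK (k ^ 2) ^ 2 - (ellK (k ^ 2) - ellE (k ^ 2)) ^ 2))).
    exact H. unfold RHS. rewrite HK, HE.
    match goal with |- scal ?x ?y = ?z => change (x * y = z) end. field. lra. }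
  split; apply is_series_Reals.
  - refine (is_series_ext _ _ _ _ S1). intros n.
    replace (PI * INR (S n) * x) with (INR (S n) * (PI * x)) by ring. reflexivity.
  - refine (is_series_ext _ _ _ _ (is_series_sinh2_sinh3 _ _ Hy S1)). intros n.
    replace (PI * (2 * INR (S n) - 1) * x / 2) with ((2 * INR (S n) - 1) * (PI * x) / 2) by field. reflexivity.
Qed.
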